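(* Let $q\in\widetilde{\mathbb C}$, $\omega\in\mathbb C$, and let $\mathcal T(\omega,q)$ be the symmetrical form such that $\sigma\mathcal T(\omega,q)=\mathcal S(\omega,q)$. Then: 1) $\mathcal T(\omega,q)$ is regular if and only if $\omega\neq q^{-n}$ for all $n\ge0$; in that case its recurrence coefficients are, for $n\ge0$, $$\gamma_{2n+1}=q^{-2n-\frac32}(1-\omega q^n),\qquad \gamma_{2n+2}=q^{-2n-\frac52}(1-q^{n+1}) .$$ It is positive definite for $0<q<1$, $\omega<1$. 2) If $\omega\neq\sqrt q$ and $\omega\neq q^{-n}$ for all $n\ge0$, then $\mathcal T(\omega,q)$ is $H_{\sqrt q}$-semiclassical of class one and satisfies $$H_{\sqrt q}\big(x(x^2+\omega q^{-\frac32})\mathcal T(\omega,q)\big)-(\sqrt q-1)^{-1}\big(x^2+(\omega-1)q^{-\frac32}\big)\mathcal T(\omega,q)=0 .$$ 3) $(\mathcal T(\omega,q))_{2n}=q^{-\frac12n(n+2)}(\omega;q)_n$ and $(\mathcal T(\omega,q))_{2n+1}=0$, $n\ge0$. 4) If $q>1$ and $\omega>1$, $$\mathcal T(\omega,q)=(\omega^{-1};q^{-1})_\infty\sum_{k=0}^\infty\frac{\omega^{-k}}{(q^{-1};q^{-1})_k}\,\frac{\delta_{-i\sqrt\omega\,q^{-\frac k2-\frac34}}+\delta_{i\sqrt\omega\,q^{-\frac k2-\frac34}}}{2} .$$ 5) If $0<q<1$ and $0<\omega<1$, then for every $f\in\mathcal P$ $$\langle\mathcal T(\omega,q),f\rangle=K\int_{-\infty}^\infty\frac{|x|^{2\frac{\ln\omega}{\ln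 q}-1}}{(-q^{\frac32}\omega^{-1}x^2;q)_\infty}f(x)\,dx,\qquad K^{-1}=\int_0^\infty\frac{x^{\frac{\ln\omega}{\ln q}-1}}{(-q^{\frac32}\omega^{-1}x;q)_\infty}\,dx .$$ 6) If $0<q<1$, then for every $f\in\mathcal P$ $$\langle\mathcal T(0,q),f\rangle=\sqrt{\frac{q}{2\pi\ln q^{-1}}}\int_{-\infty}^\infty|x|\exp\left(\frac{-2\ln^2|x|}{\ln q^{-1}}\right)f(x)\,dx .$$
   Context: $\mathcal P$ is the vector space of polynomials in one variable with complex coefficients and $\mathcal P'$ its dual; elements of $\mathcal P'$ are called forms; $\langle u,f\rangle$ is the action of $u$ on $f$ and $(u)_n=\langle u,x^n\rangle$ are the moments. All regular forms are normalized by $(u)_0=1$. A form is symmetrical if $(u)_{2n+1}=0$ for all $n\ge0$. Let $\widetilde{\mathbb C}=\{z\in\mathbb C: z\neq0,\ z^n\neq1\ \forall n\ge1\}$; $\sqrt{\cdot}$ is the principal square root and half-integer powers of $q$ are powers of $\sqrt q$. $(a;q)_0=1$, $(a;q)_n=\prod_{k=1}^n(1-aq^{k-1})$, and $(a;q)_\infty=\prod_{k\ge0}(1-aq^k)$ for $|q|<1$. $\delta_c$ is the form $\langle\delta_c,f\rangle=f(c)$; equalities with series of forms mean equality (with convergence) when applied to every polynomial. For a polynomial $g$, $\langle gu,f\rangle=\langle u,gf\rangle$. For $r\in\widetilde{\mathbb C}$, $(H_rf)(x)=\frac{f(rx)-f(x)}{(r-1)x}$ and $\langle H_ru,f\rangle=-\langle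 u,H_rf\rangle$. The form $\sigma u$ is defined by $\langle\sigma u,f\rangle=\langle u,f(x^2)\rangle$. A form $u$ is regular if there is a sequence of monic polynomials $\{B_n\}_{n\ge0}$, $\deg B_n=n$, with $\langle u,B_mB_n\rangle=r_n\delta_{n,m}$, $r_n\ne0$; then $B_0=1$, $B_1=x-\beta_0$, $B_{n+2}=(x-\beta_{n+1})B_{n+1}-\gamma_{n+1}B_n$ with $\gamma_{n+1}\neq0$, $n\ge0$ (for symmetrical $u$ all $\beta_n=0$); the $\gamma_{n+1}$ are the recurrence coefficients. A symmetrical regular form is positive definite if all its $\gamma_{n+1}$ are positive reals. A form $u$ is $H_r$-semiclassical if it is regular and $H_r(\Phi u)+\Psi u=0$ for some polynomials $\Phi$ (monic, degree $t\ge0$) and $\Psi$ (degree $p\ge1$). It is of class $s=\max(p-1,t-2)$ if the pair $(\Phi,\Psi)$ satisfies $$\prod_{c\in\mathcal Z_\Phi}\Big\{\big|r\Psi(rc)+(H_r\Phi)(c)\big|+\big|\langle u,\ r(\theta_{cr}\Psi)+\theta_{cr}(\theta_c\Phi)\rangle\big|\Big\}>0,$$ where $\mathcal Z_\Phi$ is the set of zeros of $\Phi$ and $(\theta_cf)(x)=\frac{f(x)-f(c)}{x-c}$. $\mathcal S(\omega,q)$ (the generalized Stieltjes–Wigert form) is the form with $(\mathcal S(\omega,q))_0=1$ satisfying $H_q\big(x(x+\omega q^{-\frac32})\mathcal S(\omega,q)\big)-(q-1)^{-1}\big(x+(\omega-1)q^{-\frac32}\big)\mathcal S(\omega,q)=0$.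 *)

(* Defs.v *)
From HB Require Import structures.
From mathcomp Require Import all_boot all_order all_algebra.
From mathcomp Require Import ring complex.
From mathcomp Require Import all_classical all_reals all_analysis.

Set Implicit Arguments.
Unset Strict Implicit.
Unset Printing Implicit Defensive.

Import Order.TTheory GRing.Theory Num.Theory.
Import numFieldNormedType.Exports.

Local Open Scope classical_set_scope.
Local Open Scope ring_scope.
Local Open Scope complex_scope.

(* Neither zero nor a root of unity. *)
Definition Ctilde (F : fieldType) (z : F) : Prop :=
  z != 0 /\ forall n : nat, z ^+ n.+1 != 1.

Notation polyform F := {scalar {poly F}}.

Section Operators.
Variable F : fieldType.
Implicit Types (f g Phi Psi : {poly F}) (u : polyform F).

(* (f(rx) - f(x)) / ((r - 1) x); for r != 1 the polynomial division is exact. *)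
Definition Hop (r : F) f : {poly F} :=
  (f \Po (r *: 'X) - f) %/ ((r - 1) *: 'X).

(* (f(x) - f(c)) / (x - c); the polynomial division is exact. *)
Definition theta (c : F) f : {poly F} := (f - f.[c]%:P) %/ ('X - c%:P).

Definition form_mul_def g u f : F := u (g * f).
Definition form_H_def r u f : F := - u (Hop r f).
Definition form_sigma_def u f : F := u (f \Po 'X^2).

Fact form_mul_linear g u : scalar (form_mul_def g u).
Proof. by move=> a f h; rewrite /form_mul_def mulrDr -scalerAr linearP. Qed.

Fact Hop_linear r : linear (Hop r).
Proof.
move=> a f h; rewrite /Hop comp_polyD comp_polyZ.
by rewrite opprD addrACA -scalerBr divpD divpZl.
Qed.

Fact form_H_linear r u : scalar (form_H_def r u).
Proof. by move=> a f h; rewrite /form_H_def Hop_linear linearP opprD mulrN. Qed.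

Fact form_sigma_linear u : scalar (form_sigma_def u).
Proof.
by move=> a f h; rewrite /form_sigma_def comp_polyD comp_polyZ linearP.
Qed.

HB.instance Definition _ g u :=
  GRing.isLinear.Build F {poly F} F *%R (form_mul_def g u) (form_mul_linear g u).
HB.instance Definition _ r u :=
  GRing.isLinear.Build F {poly F} F *%R (form_H_def r u) (form_H_linear r u).
HB.instance Definition _ u :=
  GRing.isLinear.Build F {poly F} F *%R (form_sigma_def u) (form_sigma_linear u).

Definition form_mul g u : polyform F := form_mul_def g u.
Definition form_H r u : polyform F := form_H_def r u.
Definition form_sigma u : polyform F := form_sigma_def u.

Definition moment u (n : nat) : F := u 'X^n.

Definition symmetrical u : Prop := forall n : nat, moment u (n.*2.+1) = 0.

(* H_r(Phi u) + Psi u = 0 *)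
Definition H_equation r Phi Psi u : Prop :=
  forall f, form_H r (form_mul Phi u) f + form_mul Psi u f = 0.

(* Recall that size p = deg p + 1. *)
Definition monic_orthogonal u (B : nat -> {poly F}) : Prop :=
  (forall n, B n \is monic /\ size (B n) = n.+1) /\
  exists r : nat -> F, (forall n, r n != 0) /\
    forall m n, u (B m * B n) = r n * (n == m)%:R.

Definition regular_form u : Prop := exists B, monic_orthogonal u B.

(* gamma is used from index 1 on; gamma 0 is irrelevant. *)
Definition recurrence_coefficients u (beta gamma : nat -> F) : Prop :=
  exists B, [/\ monic_orthogonal u B, B 0 = 1, B 1 = 'X - (beta 0)%:P,
    forall n, B n.+2 = ('X - (beta n.+1)%:P) * B n.+1 - gamma n.+1 *: B n
    & forall n, gamma n.+1 != 0].

Definition H_semiclassical_pair r u Phi Psi : Prop :=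
  [/\ Phi \is monic, (1 < size Psi)%N & H_equation r Phi Psi u].

Definition qpoch (a q : F) (n : nat) : F :=
  \prod_(1 <= k < n.+1) (1 - a * q ^+ k.-1).

End Operators.

Section Forms.
Variable F : fieldType.
Implicit Types u v : polyform F.

Definition form_of_moments_def (m : nat -> F) (f : {poly F}) : F :=
  \sum_(i < size f) f`_i * m i.

Fact form_of_moments_widen m n (f : {poly F}) : (size f <= n)%N ->
  form_of_moments_def m f = \sum_(i < n) f`_i * m i.
Proof.
move=> le_fn; rewrite /form_of_moments_def (big_ord_widen _ (fun i => f`_i * m i) le_fn).
rewrite big_mkcond; apply: eq_bigr => i _; case: ifPn => //.
by rewrite -leqNgt => /(nth_default 0) ->; rewrite mul0r.
Qed.

Fact form_of_moments_linear m : scalar (form_of_moments_def m).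
Proof.
move=> a f g; set n := maxn (size (a *: f + g)) (maxn (size f) (size g)).
rewrite !(@form_of_moments_widen m n) ?leq_max ?leqnn ?orbT //.
by rewrite mulr_sumr -big_split; apply: eq_bigr => i _; rewrite coefD coefZ mulrDl mulrA.
Qed.

HB.instance Definition _ m :=
  GRing.isLinear.Build F {poly F} F *%R (form_of_moments_def m)
    (form_of_moments_linear m).

Fact form_of_momentsP (m : nat -> F) :
  exists u : polyform F, forall n, moment u n = m n.
Proof.
exists (form_of_moments_def m : polyform F) => n.
rewrite /moment /= /form_of_moments_def size_polyXn big_ord_recr /= coefXn eqxx.
by rewrite mul1r big1 ?add0r // => i _; rewrite coefXn ltn_eqF // mul0r.
Qed.

Fact eq_form (u v : polyform F) : (forall n, moment u n = moment v n) -> u =1 v.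
Proof.
move=> uv f; rewrite -[f]coefK poly_def !linear_sum; apply: eq_bigr => i _.
by rewrite !linearZ; congr (_ * _); exact: uv.
Qed.

Fact Hop_Xn (r : F) n : r != 1 ->
  Hop r 'X^n = ((r ^+ n - 1) / (r - 1)) *: 'X^(n.-1).
Proof.
rewrite -subr_eq0 => r1; rewrite /Hop.
have nz : (r - 1) *: 'X != 0 :> {poly F} by rewrite scaler_eq0 polyX_eq0 orbF.
rewrite comp_Xn_poly exprZn -[X in _ - X]scale1r -scalerBl.
case: n => [|n]; first by rewrite expr0 subrr mul0r !scale0r div0p.
apply: (mulIf nz); rewrite divpK.
  set b := _ / _; have -> : r ^+ n.+1 - 1 = b * (r - 1) by rewrite divfK.
  by rewrite -!mul_polyC polyCM exprSr; ring.
by rewrite dvdpZl // -mul_polyC (exprSr 'X) mulrA dvdp_mull.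
Qed.

Fact H_equationP r Phi Psi u :
  H_equation r Phi Psi u <->
  forall n, form_H r (form_mul Phi u) 'X^n + form_mul Psi u 'X^n = 0.
Proof.
split=> [E n|E f]; first exact: E.
rewrite -[f]coefK poly_def !linear_sum -big_split big1 // => i _ /=.
by rewrite !linearZ /= -mulrDr E mulr0.
Qed.

Fact symmetrical_sigma_unique u v :
  symmetrical u -> symmetrical v -> form_sigma u =1 form_sigma v -> u =1 v.
Proof.
move=> su sv uv; apply: eq_form => n; rewrite -[n]odd_double_half.
case: (odd n); first by rewrite add1n su sv.
have := uv 'X^(n./2); rewrite /= /form_sigma_def comp_Xn_poly -exprM.
by rewrite /moment add0n mul2n.
Qed.

Fact symmetrical_sigma_exists v :
  exists u, symmetrical u /\ form_sigma u =1 v.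
Proof.
have [u um] := form_of_momentsP (fun n => if odd n then 0 else moment v n./2).
exists u; split=> [n|]; first by rewrite um /= odd_double.
apply: eq_form => n; rewrite {1}/moment /= /form_sigma_def comp_Xn_poly -exprM.
by have := um (2 * n)%N; rewrite /moment mul2n odd_double doubleK.
Qed.

End Forms.

Section Order.
Variable F : numFieldType.
Implicit Types (u : polyform F) (Phi Psi : {poly F}).

(* In the order of R[i], 0 < z says that z is real and positive. *)
Definition positive_definite u : Prop :=
  [/\ symmetrical u, regular_form u &
    exists beta gamma, recurrence_coefficients u beta gamma /\
      forall n, 0 < gamma n.+1].

Definition class_condition (r : F) u Phi Psi : Prop :=
  0 < \big[*%R/1]_(c \in [set c : F | root Phi c])
        (`|r * Psi.[r * c] + (Hop r Phi).[c]| +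
         `|u (r *: theta (c * r) Psi + theta (c * r) (theta c Phi))|).

(* With p = size Psi - 1 >= 1 and t = size Phi - 1, truncated subtraction does
   not affect max (p - 1, t - 2). *)
Definition H_semiclassical_of_class (r : F) u (s : nat) : Prop :=
  regular_form u /\
  exists Phi Psi, [/\ H_semiclassical_pair r u Phi Psi,
    class_condition r u Phi Psi
    & s = maxn ((size Psi).-1 - 1) ((size Phi).-1 - 2)].

(* Meaningful for |q| < 1. *)
Definition qpoch_inf (a q : F) : F := lim (qpoch a q n @[n --> \oo]).

(* u = a * (v 0 + v 1 + ...), with convergence on every polynomial. *)
Definition is_form_series u (a : F) (v : nat -> {poly F} -> F) : Prop :=
  forall f : {poly F}, let s := series (fun k => v k f) in
    cvgn s /\ u f = a * limn s.

End Order.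

Section Complex.
Variable R : realType.
Local Notation C := R[i].
Local Notation mu := (@lebesgue_measure R).

(* sqrtc is the principal square root; q^(-3/2) is read as (sqrtc q)^(-3). *)
Definition is_SW (q w : C) (S : polyform C) : Prop :=
  moment S 0 = 1 /\
  H_equation q ('X * ('X + (w * sqrtc q ^- 3)%:P))
    (- ((q - 1)^-1 *: ('X + ((w - 1) * sqrtc q ^- 3)%:P))) S.

Fact is_SW_momentP (q w : C) (S : polyform C) : Ctilde q ->
  is_SW q w S <-> moment S 0 = 1 /\
    forall n, moment S n.+1 = (sqrtc q ^- 3 * (1 - w * q ^+ n) / q ^+ n) * moment S n.
Proof.
move=> [q0 /(_ 0%N)]; rewrite expr1 => q1; set h := sqrtc q ^- 3.
have q10 : q - 1 != 0 by rewrite subr_eq0.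
suff E n : (form_H q (form_mul ('X * ('X + (w * h)%:P)) S) 'X^n +
   form_mul (- ((q - 1)^-1 *: ('X + ((w - 1) * h)%:P))) S 'X^n == 0) =
   (moment S n.+1 == (h * (1 - w * q ^+ n) / q ^+ n) * moment S n).
  split=> -[S0 H]; split=> //.
    by move=> n; apply/eqP; rewrite -E; apply/eqP; exact: H.
  by apply/H_equationP => n; apply/eqP; rewrite E; apply/eqP; exact: H.
have SZ a f : S (a *: f) = a * S f by exact: linearZ.
have SD f g : S (f + g) = S f + S g by exact: raddfD.
have qn0 : q ^+ n != 0 by rewrite expf_neq0.
have -> : form_mul (- ((q - 1)^-1 *: ('X + ((w - 1) * h)%:P))) S 'X^n =
    - ((q - 1)^-1 * (moment S n.+1 + (w - 1) * h * moment S n)).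
  rewrite /= /form_mul_def mulNr -scalerAl mulrDl -exprS mul_polyC.
  by rewrite raddfN /= SZ SD SZ.
have -> : form_H q (form_mul ('X * ('X + (w * h)%:P)) S) 'X^n =
    - ((q ^+ n - 1) / (q - 1) * (moment S n.+1 + w * h * moment S n)).
  rewrite /= /form_H_def Hop_Xn // linearZ /= /form_mul_def.
  case: (n) => [|k]; first by rewrite expr0 subrr !mul0r.
  have -> : 'X * ('X + (w * h)%:P) * 'X^(k.+1.-1) =
    'X^(k.+2) + (w * h) *: 'X^(k.+1) :> {poly C}.
    by rewrite -mul_polyC /= 2!exprS; ring.
  by rewrite SD SZ.
set m1 := moment S n.+1; set m0 := moment S n.
have fE (K : fieldType) (d Q a b x y : K) : d != 0 -> Q != 0 ->
    - ((Q - 1) / d * (x + a * b * y)) + - (d^-1 * (x + (a - 1) * b * y)) =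
    - (Q / d) * (x - b * (1 - a * Q) / Q * y).
  by move=> d0 Q0; field; rewrite d0 Q0.
rewrite -(subr_eq0 m1) fE //.
by rewrite mulf_eq0 oppr_eq0 mulf_eq0 invr_eq0 (negbTE qn0) (negbTE q10).
Qed.

Fact is_SW_exists_unique (q w : C) : Ctilde q ->
  (exists S, is_SW q w S) /\
  (forall S S', is_SW q w S -> is_SW q w S' -> S =1 S').
Proof.
move=> qC; split.
  have [S Sm] := form_of_momentsP
    (fun n => \prod_(k < n) (sqrtc q ^- 3 * (1 - w * q ^+ k) / q ^+ k)).
  exists S; apply/(is_SW_momentP _ _ qC); split; first by rewrite Sm big_ord0.
  by move=> n; rewrite !Sm big_ord_recr; exact: mulrC.
move=> S S' /(is_SW_momentP _ _ qC)[S0 E] /(is_SW_momentP _ _ qC)[S0' E'].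
by apply: eq_form; elim=> [|n IHn]; rewrite ?S0 // E E' IHn.
Qed.

Definition Cintegrable (g : R -> C) : Prop :=
  mu.-integrable setT (EFin \o (fun x => complex.Re (g x))) /\
  mu.-integrable setT (EFin \o (fun x => complex.Im (g x))).

Definition Cintegral (g : R -> C) : C :=
  (\int[mu]_x complex.Re (g x)) +i* (\int[mu]_x complex.Im (g x)).

End Complex.

(* Main.v *)
Require Import Defs.
From HB Require Import structures.
From mathcomp Require Import all_boot all_order all_algebra.
From mathcomp Require Import ring lra zify complex.
From mathcomp Require Import all_classical all_reals all_analysis.
From mathcomp Require Import measurable_realfun.

Set Implicit Arguments.
Unset Strict Implicit.
Unset Printing Implicit Defensive.

Import Order.TTheory GRing.Theory Num.Theory.
Import numFieldNormedType.Exports.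

Local Open Scope classical_set_scope.
Local Open Scope ring_scope.
Local Open Scope complex_scope.

(** Write s for the square root of q. Applied to x^n, the equation that defines
S(w, q) is a two-term recurrence for its moments. Since T is symmetrical and
sigma T = S, these are the even moments of T, so that T is determined by

  <T, x^(2n+2)> = s^(-2n-3) (1 - w q^n) <T, x^(2n)>,   <T, 1> = 1,

and each assertion amounts to recognizing this recurrence.

Orthogonality. Let B_n be generated by the announced coefficients gamma_n. The
numbers <T, x^(2m) B_(2p)> and <T, x^(2m+1) B_(2p+1)> have a closed form
(sw_pairing): a moment of T, times a power of s, times the product of the q^i - q^m
for i < p. It vanishes for m < p, and for m = p it is nonzero for every p exactly
when no factor 1 - w q^k vanishes. Thus T is regular for w outside the powers q^-k;
for w = q^-k some monic B_n is orthogonal to all polynomials of degree at most n,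
which a regular form forbids (regular_pairing_neq0).

Semiclassical character. The equation of base s, applied to x^n, is again the
moment recurrence. At the zeros of Phi the first term of the class criterion equals
s^-3 (s - w) / (s - 1) or s^-2 / (s - 1) (sw_class_term_neq0).

Discrete representation. The series E(x) of the x^k / (p; p)_k satisfies
(1 - x) E(x) = E(p x), whence (x; p)_N E(x) = E(p^N x) tends to 1: this is Euler's
identity. With p = 1/q, the even moments of the sum of point masses are, up to powers of w and s,
the values of E at w^-1 p^m, and the functional equation compares them with E(w^-1).

Integral representations. Both weights are even, so odd moments vanish and even ones
are integrals over the half-line, which x = e^t turns into integrals over the line
(even_weight_moment). For the infinite product, the translation t -> t + ln q
together with (- y; q)_oo = (1 + y) (- q y; q)_oo yields the recurrence (mellin_shift),
and K normalizes the moment of order 0. For w = 0 the integrand is a Gaussian in t,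
whose integral is known (lognormal_moment). *)

(** * The finite q-Pochhammer symbol *)

Section QPochhammer.
Variable F : fieldType.
Implicit Types a q : F.

Lemma qpoch_prod a q n : qpoch a q n = \prod_(k < n) (1 - a * q ^+ k).
Proof. by rewrite /qpoch big_add1 /= big_mkord. Qed.

Lemma qpoch0 a q : qpoch a q 0 = 1.
Proof. by rewrite qpoch_prod big_ord0. Qed.

Lemma qpochS a q n : qpoch a q n.+1 = qpoch a q n * (1 - a * q ^+ n).
Proof. by rewrite !qpoch_prod big_ord_recr. Qed.

Lemma qpochSl a q n : qpoch a q n.+1 = (1 - a) * qpoch (a * q) q n.
Proof.
rewrite !qpoch_prod big_ord_recl /= expr0 mulr1; congr (_ * _).
by apply: eq_bigr => i _; rewrite /bump /= ?add1n exprS mulrA.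
Qed.

End QPochhammer.

(** * Regular forms and symmetric three-term recurrences *)

Section Orthogonal.
Variable F : fieldType.
Implicit Types (u : polyform F) (f g : {poly F}) (B : nat -> {poly F}).

Lemma formD u f g : u (f + g) = u f + u g. Proof. exact: linearD. Qed.
Lemma formB u f g : u (f - g) = u f - u g. Proof. exact: linearB. Qed.
Lemma formZ u a f : u (a *: f) = a * u f. Proof. exact: linearZ. Qed.

(** Against a polynomial g orthogonal to the lower powers of x, a polynomial of
degree at most n is seen only through its coefficient of degree n. *)
Lemma form_shift_coef u g n :
  (forall j, (j < n)%N -> u ('X^j * g) = 0) ->
  forall f, (size f <= n.+1)%N -> u (f * g) = f`_n * u ('X^n * g).
Proof.
move=> ug0 f sf; rewrite -[f in LHS]coefK poly_def.
rewrite (big_ord_widen n.+1 (fun i => f`_i *: 'X^i) sf) mulr_suml.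
rewrite linear_sum /= big_mkcond big_ord_recr /= big1 ?add0r => [|i _].
  rewrite -scalerAl formZ; case: ifPn => //.
  by rewrite -leqNgt => /(nth_default 0) ->; rewrite mul0r.
by rewrite -scalerAl formZ ug0 // mulr0; case: ifP; rewrite ?linear0.
Qed.

Lemma form_small_orthogonal u B g n :
  (forall m, B m \is monic /\ size (B m) = m.+1) ->
  (forall m, (m < n)%N -> u (B m * g) = 0) ->
  forall f, (size f <= n)%N -> u (f * g) = 0.
Proof.
move=> Bm; elim: n => [|n IHn] ug0 f.
  by rewrite leqn0 size_poly_eq0 => /eqP->; rewrite mul0r linear0.
move=> sf; have [mB sB] := Bm n.
rewrite -(subrK (f`_n *: B n) f) mulrDl formD -scalerAl formZ ug0 //.
rewrite mulr0 addr0 IHn // => [m mn|]; first by apply: ug0; exact: ltnW.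
have cB : (B n)`_n = 1 by move: mB; rewrite monicE lead_coefE sB => /eqP.
apply/leq_sizeP => j; rewrite leq_eqVlt => /orP[/eqP <-|nj].
  by rewrite coefB coefZ cB mulr1 subrr.
have sfj := leq_trans sf nj.
by rewrite coefB coefZ (nth_default _ sfj) (@nth_default _ _ (B n)) ?sB // mulr0 subrr.
Qed.

(** If (B n) is the orthogonal family, a monic g of degree n differs from B n by a polynomial
of lower degree, which B n annihilates; hence <u, B n g> = <u, (B n)^2>, which is not 0. *)
Lemma regular_pairing_neq0 u g n : regular_form u ->
  g \is monic -> size g = n.+1 ->
  exists2 f : {poly F}, (size f <= n.+1)%N & u (f * g) != 0.
Proof.
move=> [B [Bm [r [r0 ur]]]] mg sg; exists (B n); first by rewrite (Bm n).2.
have [mB sB] := Bm n.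
have low (f : {poly F}) : (size f <= n)%N -> u (f * B n) = 0.
  apply: (form_small_orthogonal Bm) => m mn.
  by rewrite ur gtn_eqF // mulr0.
rewrite mulrC -(subrK (B n) g) mulrDl formD low ?add0r.
  by rewrite ur eqxx mulr1.
apply/leq_sizeP => j; rewrite leq_eqVlt => /orP[/eqP <-|nj].
  move: mB mg; rewrite !monicE !lead_coefE sB sg => /eqP cB /eqP cg.
  by rewrite coefB cB cg subrr.
by rewrite coefB !nth_default ?subrr // ?sB ?sg.
Qed.

Fixpoint sym_recurrence (gamma : nat -> F) (n : nat) : {poly F} :=
  match n with
  | 0 => 1
  | n1.+1 => match n1 with
    | 0 => 'X
    | n2.+1 => 'X * sym_recurrence gamma n1 - gamma n1 *: sym_recurrence gamma n2
    end
  end.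

Lemma sym_recurrenceSS gamma n : sym_recurrence gamma n.+2 =
  'X * sym_recurrence gamma n.+1 - gamma n.+1 *: sym_recurrence gamma n.
Proof. by []. Qed.

Lemma sym_recurrence_monic gamma n :
  sym_recurrence gamma n \is monic /\ size (sym_recurrence gamma n) = n.+1.
Proof.
suff [] : (sym_recurrence gamma n \is monic /\ size (sym_recurrence gamma n) = n.+1) /\
  (sym_recurrence gamma n.+1 \is monic /\ size (sym_recurrence gamma n.+1) = n.+2) by [].
elim: n => [|n [[m0 s0] [m1 s1]]].
  by rewrite /= monic1 monicX size_poly1 size_polyX.
split=> //; rewrite sym_recurrenceSS.
have n1 : sym_recurrence gamma n.+1 != 0 by rewrite -size_poly_eq0 s1.
have sX : size ('X * sym_recurrence gamma n.+1)%R = n.+3.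
  by rewrite mulrC size_mulX // s1.
have lt : (size (- (gamma n.+1 *: sym_recurrence gamma n)) <
           size ('X * sym_recurrence gamma n.+1)%R)%N.
  by rewrite size_polyN sX ltnS (leq_trans (size_scale_leq _ _)) // s0.
rewrite monicE lead_coefDl // size_polyDl // sX; split=> //.
by rewrite -monicE monicMl // monicX.
Qed.

Lemma sym_recurrence_parity u gamma n j :
  symmetrical u -> odd (j + n) -> u ('X^j * sym_recurrence gamma n) = 0.
Proof.
move=> su; suff [] : (forall j, odd (j + n) -> u ('X^j * sym_recurrence gamma n) = 0) /\
  (forall j, odd (j + n.+1) -> u ('X^j * sym_recurrence gamma n.+1) = 0) by move=> H _; exact: H.
have u0 k : odd k -> u 'X^k = 0.
  by move=> ok; rewrite -[k]odd_double_half ok add1n; exact: su.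
elim: n {j} => [|n [IH0 IH1]].
  split=> j; rewrite ?addn0 ?addn1 /= ?mulr1 -?exprSr => o; exact: u0.
split=> // j o; rewrite sym_recurrenceSS mulrBr mulrA -exprSr -scalerAr.
rewrite formB formZ IH1 ?IH0 ?mulr0 ?subrr //.
  by move: o; rewrite !addnS /= negbK.
by move: o; rewrite addnS.
Qed.

Definition low_orthogonal u B := forall n j, (j < n)%N -> u ('X^j * B n) = 0.

Lemma low_orthogonal_monic u B :
  (forall m, B m \is monic /\ size (B m) = m.+1) -> low_orthogonal u B ->
  (forall n, u ('X^n * B n) != 0) -> monic_orthogonal u B.
Proof.
move=> Bm lo nz; split=> //; exists (fun n => u ('X^n * B n)); split=> // m n.
have lt m' n' : (m' <= n')%N -> u (B m' * B n') = u ('X^n' * B n') * (n' == m')%:R.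
  move=> mn; have sB := (Bm m').2.
  rewrite (@form_shift_coef u (B n') n') ?sB //; last by move=> j; exact: lo.
  case: eqP => [->|/eqP nm]; last first.
    by rewrite nth_default ?mul0r ?mulr0 // sB ltn_neqAle eq_sym nm.
  move: (Bm m').1; rewrite monicE lead_coefE sB => /eqP ->.
  by rewrite mul1r mulr1.
have [mn|nm] := leqP m n; first exact: lt.
rewrite mulrC lt 1?ltnW // eq_sym; case: eqP => [->//|_].
by rewrite !mulr0.
Qed.

Lemma low_orthogonal_regular_neq0 u B n :
  (forall m, B m \is monic /\ size (B m) = m.+1) -> low_orthogonal u B ->
  regular_form u -> u ('X^n * B n) != 0.
Proof.
move=> Bm lo ru; have [f sf] := regular_pairing_neq0 ru (Bm n).1 (Bm n).2.
rewrite (@form_shift_coef u (B n) n) // => [|j]; last exact: lo.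
by rewrite mulf_eq0 negb_or => /andP[].
Qed.

End Orthogonal.

(** * Symmetric forms with Stieltjes-Wigert moments *)

Section StieltjesWigert.
Variables (F : fieldType) (s w : F) (T : polyform F).
Hypothesis s0 : s != 0.
Hypothesis symT : symmetrical T.
Hypothesis T1 : moment T 0 = 1.
Hypothesis Trec : forall m, moment T (2 * m.+1) =
  s ^- (2 * m + 3) * (1 - w * s ^+ (2 * m)) * moment T (2 * m).

(** The two recurrence sequences in a single formula in the index j: s stands for
the square root of q, and 2 j + 1 is 4 n + 3 for j = 2 n + 1 and 4 n + 5 for j = 2 n + 2. *)
Definition sw_gamma (j : nat) : F :=
  s ^- (2 * j + 1) * (1 - (if odd j then w * s ^+ j.-1 else s ^+ j)).

Let B := sym_recurrence sw_gamma.
Let q := s ^+ 2.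
Let D p m := \prod_(i < p) (q ^+ i - q ^+ m).

(** The closed form of every pairing that parity does not annihilate. The recurrences of B
and of the moments give it by induction on p, for all m at once. The factor D p m contains
q^m - q^m when m < p, which is the orthogonality. At m = p it is nonzero as soon as q is not
a root of unity, so that the vanishing of the diagonal is governed by the moments, that is
by the factors 1 - w q^k. *)
Lemma sw_pairing p m :
  T ('X^(2 * m) * B (2 * p)) =
    moment T (2 * m) * D p m * s ^- (2 * p ^ 2 + p + 2 * p * m) /\
  T ('X^(2 * m + 1) * B (2 * p + 1)) =
    moment T (2 * m.+1) * D p m * s ^- (2 * p ^ 2 + 3 * p + 2 * p * m).
Proof.
elim: p m => [|p IHp] m.
  rewrite /D !big_ord0 !muln0 !add0n /B /= !mulr1 -exprSr !expr0 invr1 !mulr1.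
  by split=> //; rewrite /moment; congr (T 'X^_); lia.
have n0 k : s ^+ k != 0 by rewrite expf_neq0.
set A := s ^+ (2 * p ^ 2 + p + 2 * p * m); set P := s ^+ p; set M := s ^+ m.
have D1 k : D p.+1 k = D p k * (P ^+ 2 - (s ^+ k) ^+ 2).
  by rewrite /D big_ord_recr /= /q /P -!exprM ![(_ * 2)%N]mulnC.
have even k : T ('X^(2 * k) * B (2 * p.+1)) =
    moment T (2 * k) * D p.+1 k * s ^- (2 * p.+1 ^ 2 + p.+1 + 2 * p.+1 * k).
  have -> : B (2 * p.+1) = 'X * B (2 * p).+1 - sw_gamma (2 * p).+1 *: B (2 * p).
    by have -> : (2 * p.+1 = (2 * p).+2)%N by lia.
  rewrite mulrBr mulrA -exprSr -scalerAr formB formZ.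
  have [E O] := IHp k.
  move: O; rewrite !addn1 => ->; rewrite E Trec D1.
  set Ak := s ^+ (2 * p ^ 2 + p + 2 * p * k); set K := s ^+ k.
  have -> : s ^+ (2 * p ^ 2 + 3 * p + 2 * p * k) = Ak * P ^+ 2.
    by rewrite /Ak /P -exprM -exprD; congr (_ ^+ _); lia.
  have -> : s ^+ (2 * p.+1 ^ 2 + p.+1 + 2 * p.+1 * k) = Ak * P ^+ 4 * s ^+ 3 * K ^+ 2.
    by rewrite /Ak /P /K -!exprM -!exprD; congr (_ ^+ _); nia.
  have -> : s ^+ (2 * k + 3) = K ^+ 2 * s ^+ 3.
    by rewrite /K -!exprM -!exprD; congr (_ ^+ _); lia.
  have -> : s ^+ (2 * k) = K ^+ 2 by rewrite /K -exprM mulnC.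
  have -> : sw_gamma (2 * p).+1 = P ^- 4 * s ^- 3 * (1 - w * P ^+ 2).
    rewrite /sw_gamma /= oddM /=.
    have -> : s ^+ (2 * p) = P ^+ 2 by rewrite /P -exprM mulnC.
    congr (_ * _); rewrite -invfM; congr (_^-1).
    by rewrite /P -!exprM -!exprD; congr (_ ^+ _); lia.
  by field; rewrite /Ak /P /K !n0 s0.
split; first exact: even.
have -> : B (2 * p.+1 + 1) =
    'X * B (2 * p.+1) - sw_gamma (2 * p.+1) *: B (2 * p + 1).
  by rewrite !addn1 mulnS.
rewrite mulrBr mulrA -exprSr -scalerAr formB formZ.
have -> : ((2 * m + 1).+1 = 2 * m.+1)%N by lia.
rewrite even (IHp m).2 (D1 m) -/M.
have DS : D p.+1 m.+1 = P ^+ 2 * (1 - M ^+ 2 * q) * D p m.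
  rewrite /D big_ord_recl /= expr0; have -> : q ^+ m.+1 = M ^+ 2 * q.
    by rewrite exprSr /q /M -!exprM mulnC.
  rewrite [P ^+ 2 * _]mulrC -[RHS]mulrA; congr (_ * _).
  have -> : P ^+ 2 = q ^+ p by rewrite /P /q -!exprM mulnC.
  rewrite -[p in q ^+ p]card_ord -prodr_const -big_split; apply: eq_bigr => i _ /=.
  have -> : q ^+ m = M ^+ 2 by rewrite /q /M -!exprM mulnC.
  by rewrite /bump /= add1n exprS; ring.
rewrite DS.
have -> : s ^+ (2 * p ^ 2 + 3 * p + 2 * p * m) = A * P ^+ 2.
  by rewrite /A /P -exprM -exprD; congr (_ ^+ _); lia.
have -> : s ^+ (2 * p.+1 ^ 2 + p.+1 + 2 * p.+1 * m.+1) = A * P ^+ 6 * s ^+ 5 * M ^+ 2.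
  by rewrite /A /P /M -!exprM -!exprD; congr (_ ^+ _); nia.
have -> : s ^+ (2 * p.+1 ^ 2 + 3 * p.+1 + 2 * p.+1 * m) = A * P ^+ 6 * s ^+ 5 * M ^+ 2.
  by rewrite /A /P /M -!exprM -!exprD; congr (_ ^+ _); nia.
have -> : sw_gamma (2 * p.+1) = P ^- 4 * s ^- 5 * (1 - P ^+ 2 * q).
  rewrite /sw_gamma oddM /=.
  have -> : s ^+ (2 * p.+1) = P ^+ 2 * q.
    by rewrite /P /q -exprM -exprD; congr (_ ^+ _); lia.
  congr (_ * _); rewrite -invfM; congr (_^-1).
  by rewrite /P -!exprM -!exprD; congr (_ ^+ _); lia.
by rewrite /q; field; rewrite /A /P /M !n0 s0.
Qed.

Hypothesis qroot : forall n, q ^+ n.+1 != 1.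

Lemma sw_moment n : moment T (2 * n) = s ^- (n * (n + 2)) * qpoch w q n.
Proof.
rewrite qpoch_prod.
elim: n => [|n IHn]; first by rewrite big_ord0 T1 expr0 invr1 mulr1.
have -> : s ^+ (n.+1 * (n.+1 + 2)) = s ^+ (2 * n + 3) * s ^+ (n * (n + 2)).
  by rewrite -exprD; congr (_ ^+ _); lia.
rewrite Trec IHn big_ord_recr /= invfM exprM -/q.
by rewrite -!mulrA; congr (_ * _); rewrite mulrC -!mulrA.
Qed.

Lemma sw_low_orthogonal : low_orthogonal T B.
Proof.
move=> n j jn; have [|/negbTE par] := boolP (odd (j + n)).
  exact: sym_recurrence_parity.
have D0 p m : (m < p)%N -> D p m = 0.
  by move=> mp; rewrite /D (bigD1 (Ordinal mp)) //= subrr mul0r.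
move: par jn; rewrite oddD -[n]odd_double_half -[j]odd_double_half.
rewrite !oddD !odd_double !oddb !addbF -!mul2n.
move: (n./2) (j./2) => p m; case: (odd n); case: (odd j) => //= _ mp.
  by rewrite ![(1 + _)%N]addnC (sw_pairing p m).2 D0 ?mulr0 ?mul0r //; lia.
by rewrite !add0n (sw_pairing p m).1 D0 ?mulr0 ?mul0r //; lia.
Qed.

Lemma sw_diagonal_neq0 : (forall n, w != q ^- n) -> forall n, T ('X^n * B n) != 0.
Proof.
move=> wq n; have n0 k : s ^+ k != 0 by rewrite expf_neq0.
have q0 k : q ^+ k != 0 by rewrite /q -exprM.
have c0 k : moment T (2 * k) != 0.
  rewrite sw_moment mulf_neq0 ?invr_eq0 // qpoch_prod.
  apply/prodf_neq0 => i _; rewrite subr_eq0 eq_sym; apply: contra (wq i).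
  by move=> /eqP wi; apply/eqP; rewrite -[LHS](mulfK (q0 i)) wi mul1r.
have DD p : D p p != 0.
  apply/prodf_neq0 => i _; rewrite subr_eq0 eq_sym.
  have [j pj] : exists j, p = (i + j.+1)%N.
    by exists (p - i).-1; have := ltn_ord i; lia.
  by rewrite [in q ^+ p]pj exprD -subr_eq0 -{2}[q ^+ i]mulr1 -mulrBr mulf_neq0 // subr_eq0.
rewrite -[n]odd_double_half -mul2n; case: (odd n).
  rewrite [(true + _)%N]addnC (sw_pairing _ _).2.
  by rewrite !mulf_neq0 ?invr_eq0.
by rewrite add0n (sw_pairing _ _).1 !mulf_neq0 ?invr_eq0.
Qed.

(** If w = q^-n then all moments of order beyond 2 n vanish, and B (2 n + 1), already
orthogonal to lower degrees, becomes orthogonal to its own degree as well: no regular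
form allows this. *)
Lemma sw_regularP : regular_form T <-> forall n, w != q ^- n.
Proof.
split=> [rT n|wq]; last first.
  by exists B; apply: low_orthogonal_monic (sw_diagonal_neq0 wq);
    [exact: sym_recurrence_monic|exact: sw_low_orthogonal].
apply/eqP => wn; have := low_orthogonal_regular_neq0 (2 * n + 1)
  (sym_recurrence_monic sw_gamma) sw_low_orthogonal rT.
rewrite -/B (sw_pairing n n).2 Trec wn /q -exprM mulVf ?expf_neq0 //.
by rewrite subrr mulr0 !mul0r eqxx.
Qed.

Lemma sw_gamma_neq0 : (forall n, w != q ^- n) -> forall n, sw_gamma n.+1 != 0.
Proof.
move=> wq n; rewrite mulf_neq0 ?invr_eq0 ?expf_neq0 //.
have q0 k : q ^+ k != 0 by rewrite /q -exprM expf_neq0.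
have q2 k : s ^+ (2 * k) = q ^+ k by rewrite /q -exprM.
rewrite subr_eq0 eq_sym /= -[n]odd_double_half; case: (odd n).
  rewrite add1n -mul2n /= oddM /=.
  have -> : ((2 * n./2).+2 = 2 * (n./2).+1)%N by lia.
  by rewrite q2.
rewrite add0n -mul2n oddM /= q2; apply: contra (wq n./2) => /eqP wi.
by apply/eqP; rewrite -[LHS](mulfK (q0 n./2)) wi mul1r.
Qed.

Lemma sw_recurrence_coefficients : (forall n, w != q ^- n) ->
  recurrence_coefficients T (fun=> 0) sw_gamma.
Proof.
move=> wq; exists B; split=> //.
- apply: low_orthogonal_monic (sw_diagonal_neq0 wq);
    [exact: sym_recurrence_monic|exact: sw_low_orthogonal].
- by rewrite subr0.
- by move=> n; rewrite subr0.
- exact: sw_gamma_neq0.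
Qed.

Lemma sw_gamma_odd n : sw_gamma (2 * n + 1) = s ^- (4 * n + 3) * (1 - w * q ^+ n).
Proof.
have -> : (2 * n + 1 = (2 * n).+1)%N by lia.
by rewrite /sw_gamma /= oddM /= /q -exprM; congr (s ^- _ * _); lia.
Qed.

Lemma sw_gamma_even n : sw_gamma (2 * n + 2) = s ^- (4 * n + 5) * (1 - q ^+ n.+1).
Proof.
have -> : (2 * n + 2 = 2 * n.+1)%N by lia.
by rewrite /sw_gamma oddM /= /q -exprM; congr (s ^- _ * _); lia.
Qed.

Let Phi : {poly F} := 'X * ('X^2 + (w * s ^- 3)%:P).
Let Psi : {poly F} := - ((s - 1)^-1 *: ('X^2 + ((w - 1) * s ^- 3)%:P)).

Lemma sw_base_neq1 : s != 1.
Proof. by apply: contra (qroot 0) => /eqP s1; rewrite /q s1 !expr1n. Qed.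

(** On even powers this is the moment recurrence of T, the same that the equation of
base q expresses for the form of which T is the symmetrization; on odd powers both
terms vanish by symmetry. *)
Lemma sw_H_equation : H_equation s Phi Psi T.
Proof.
apply/H_equationP => n; have s1 : s - 1 != 0 by rewrite subr_eq0 sw_base_neq1.
have -> : form_H s (form_mul Phi T) 'X^n =
    - ((s ^+ n - 1) / (s - 1) * (moment T n.+2 + w * s ^- 3 * moment T n)).
  rewrite /= /form_H_def Hop_Xn ?sw_base_neq1 // linearZ /= /form_mul_def.
  case: n => [|k]; first by rewrite expr0 subrr !mul0r.
  have -> : Phi * 'X^(k.+1.-1) = 'X^(k.+3) + (w * s ^- 3) *: 'X^(k.+1).
    by rewrite /Phi -mul_polyC /= !exprS; ring.
  by rewrite formD formZ.
have -> : form_mul Psi T 'X^n =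
    - ((s - 1)^-1 * (moment T n.+2 + (w - 1) * s ^- 3 * moment T n)).
  rewrite /= /form_mul_def /Psi mulNr -scalerAl mulrDl -exprD mul_polyC.
  by rewrite raddfN /= formZ formD formZ.
have [on|en] := boolP (odd n).
  have odd0 k : odd k -> moment T k = 0.
    by move=> ok; rewrite -[k]odd_double_half ok add1n symT.
  by rewrite !odd0 //= ?negbK // !mulr0 addr0 !mulr0 oppr0 addr0.
have En : n = (2 * n./2)%N by rewrite -[LHS]odd_double_half (negbTE en) mul2n.
rewrite En; move: (n./2) => k {n en En}.
have -> : ((2 * k).+2 = 2 * k.+1)%N by lia.
rewrite Trec exprD invfM; set c := moment T _.
have : s ^+ (2 * k) != 0 by rewrite expf_neq0.
move: (s ^+ (2 * k)) => K K0.
by field; rewrite s1 K0 s0.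
Qed.

(** The value is s^-3 (s - w) / (s - 1) at c = 0 and s^-2 / (s - 1) at the other zeros,
where c^2 = - w s^-3. This first term alone makes the class criterion positive. *)
Lemma sw_class_term_neq0 c : w != s -> root Phi c ->
  s * Psi.[s * c] + (Hop s Phi).[c] != 0.
Proof.
move=> ws rc; have s1 : s - 1 != 0 by rewrite subr_eq0 sw_base_neq1.
have -> : Hop s Phi = (w * s ^- 3)%:P + (s ^+ 2 + s + 1) *: 'X^2.
  have -> : Phi = (w * s ^- 3) *: 'X^1 + 'X^3.
    by rewrite /Phi -mul_polyC; ring.
  rewrite Hop_linear !Hop_Xn ?sw_base_neq1 // expr1 divff // scale1r /= expr0 alg_polyC.
  congr (_ + _ *: _); have -> : s ^+ 3 - 1 = (s ^+ 2 + s + 1) * (s - 1) by ring.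
  by rewrite mulfK.
have {}rc : (c == 0) || (c ^+ 2 + w * s ^- 3 == 0).
  by move: rc; rewrite rootE /Phi !hornerE mulf_eq0.
have [c0|c0] := eqVneq c 0.
  have -> : s * Psi.[s * c] + ((w * s ^- 3)%:P + (s ^+ 2 + s + 1) *: 'X^2).[c] =
      s ^- 3 * (s - w) / (s - 1).
    by rewrite c0 /Psi !(hornerD, hornerN, hornerZ, hornerXn, hornerC); field; rewrite s0 s1.
  by rewrite !mulf_neq0 ?invr_eq0 ?expf_neq0 // subr_eq0 eq_sym.
move: rc; rewrite (negbTE c0) /= addr_eq0 => /eqP c2.
have -> : s * Psi.[s * c] + ((w * s ^- 3)%:P + (s ^+ 2 + s + 1) *: 'X^2).[c] =
    s ^- 2 / (s - 1).
  have wE : w = - (c ^+ 2) * s ^+ 3 by rewrite c2 opprK mulfVK // expf_neq0.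
  rewrite /Psi !(hornerD, hornerN, hornerZ, hornerXn, hornerC) wE.
  by field; rewrite s0 s1.
by rewrite mulf_neq0 ?invr_eq0 ?expf_neq0.
Qed.

End StieltjesWigert.

Lemma fsprod_gt0 (K : numFieldType) (I : choiceType) (A : set I) (f : I -> K) :
  (forall i, A i -> 0 < f i) -> 0 < \big[*%R/1]_(i \in A) f i.
Proof.
move=> f0; case: finite_supportP => [_|X XA _ _]; first by rewrite big_nil ltr01.
rewrite big_seq; elim/big_ind: _ => // [x y|i iX]; first exact: mulr_gt0.
by apply: f0; exact: XA.
Qed.

Section SymmetricForm.
Variable R : realType.
Local Notation C := R[i].
Variables (q w : C) (S T : polyform C).
Hypotheses (hq : Ctilde q) (hS : is_SW q w S).
Hypotheses (symT : symmetrical T) (sigmaT : form_sigma T =1 S).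
Let s := sqrtc q.

Let sq : s ^+ 2 = q. Proof. exact: sqr_sqrtc. Qed.

Let s0 : s != 0.
Proof. by rewrite -sqrf_eq0 sq; case: hq. Qed.

Let qroot n : (s ^+ 2) ^+ n.+1 != 1.
Proof. by rewrite sq; case: hq. Qed.

Let TS n : moment T (2 * n) = moment S n.
Proof. by rewrite /moment -sigmaT /= /form_sigma_def comp_Xn_poly -exprM. Qed.

Let T1 : moment T 0 = 1.
Proof. by have [S1 _] := (is_SW_momentP w S hq).1 hS; rewrite -S1 -TS. Qed.

Let Trec m : moment T (2 * m.+1) =
  s ^- (2 * m + 3) * (1 - w * s ^+ (2 * m)) * moment T (2 * m).
Proof.
have [_ Srec] := (is_SW_momentP w S hq).1 hS.
rewrite !TS Srec -/s exprD exprM sq; congr (_ * _).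
by rewrite mulrAC -invfM mulrC [s ^+ 3 * _]mulrC mulrC.
Qed.

Let wq : (forall n, w != (s ^+ 2) ^- n) <-> (forall n, w != q ^- n).
Proof. by rewrite sq. Qed.

Lemma symSW_regularP : regular_form T <-> forall n, w != q ^- n.
Proof. by rewrite -wq; exact: sw_regularP. Qed.

Lemma symSW_recurrence : (forall n, w != q ^- n) ->
  recurrence_coefficients T (fun=> 0) (sw_gamma s w).
Proof. by move=> H; exact: (sw_recurrence_coefficients s0 symT T1 Trec qroot (wq.2 H)). Qed.

Lemma symSW_gamma n :
  sw_gamma s w (2 * n + 1) = s ^- (4 * n + 3) * (1 - w * q ^+ n) /\
  sw_gamma s w (2 * n + 2) = s ^- (4 * n + 5) * (1 - q ^+ n.+1).
Proof. by rewrite -sq; split; [exact: sw_gamma_odd|exact: sw_gamma_even]. Qed.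

Lemma symSW_moment n :
  moment T (2 * n) = s ^- (n * (n + 2)) * qpoch w q n /\
  moment T (2 * n + 1) = 0.
Proof.
by rewrite (sw_moment s0 T1 Trec) sq; split=> //; rewrite addn1 mul2n; exact: symT.
Qed.

Lemma symSW_positive_definite : 0 < q -> q < 1 -> w < 1 -> positive_definite T.
Proof.
move=> q0 q1 w1; have s_gt0 : 0 < s.
  rewrite lt_neqAle eq_sym s0 /=.
  by rewrite /s sqrtc_ge0 ltW.
have qn n : q ^+ n <= 1 by rewrite exprn_ile1 // ltW.
have wqn n : 0 < 1 - w * q ^+ n.
  have wr : w \is Num.real by rewrite (ler_real (ltW w1)) real1.
  rewrite subr_gt0; have [w_le0|w_gt0] := real_leP wr (real0 C).
    apply: le_lt_trans (ltr01); rewrite mulr_le0_ge0 // ltW // exprn_gt0 //.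
  by apply: le_lt_trans w1; rewrite ler_piMr // ltW.
have wq' n : w != q ^- n.
  apply/negP => /eqP wn; have := wqn n.
  by rewrite wn mulVf ?subrr ?ltxx // expf_neq0 // gt_eqF.
split=> //; first exact/symSW_regularP.
exists (fun=> 0), (sw_gamma s w); split; first exact: symSW_recurrence.
move=> n; rewrite mulr_gt0 ?invr_gt0 ?exprn_gt0 //= -[n]odd_double_half -mul2n.
case: (odd n); rewrite ?add0n ?add1n /= oddM /=.
  rewrite subr_gt0 exprn_ilt1 // ?ltW //.
  by rewrite -(@ltr_pXn2r _ 2) ?nnegrE ?ltW // expr1n sq.
by rewrite exprM sq.
Qed.

Lemma symSW_semiclassical : w != s -> (forall n, w != q ^- n) ->
  H_semiclassical_of_class s T 1 /\
  H_equation s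
    ('X * ('X^2 + (w * s ^- 3)%:P))
    (- ((s - 1)^-1 *: ('X^2 + ((w - 1) * s ^- 3)%:P))) T.
Proof.
move=> ws wq'; have HE := sw_H_equation s0 symT Trec qroot.
have s1 : s - 1 != 0 by rewrite subr_eq0 (sw_base_neq1 qroot).
have sX c : size ('X^2 + c%:P : {poly C}) = 3%N.
  by rewrite size_polyDl size_polyXn // (leq_ltn_trans (size_polyC_leq1 _)).
have mX c : 'X^2 + c%:P \is @monic C.
  by rewrite monicE lead_coefDl ?lead_coefXn // size_polyXn (leq_ltn_trans (size_polyC_leq1 _)).
have sPsi : size (- ((s - 1)^-1 *: ('X^2 + ((w - 1) * s ^- 3)%:P))) = 3%N.
  by rewrite size_polyN size_scale ?sX // invr_eq0.
split=> //; split; first exact/symSW_regularP.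
exists ('X * ('X^2 + (w * s ^- 3)%:P)), (- ((s - 1)^-1 *: ('X^2 + ((w - 1) * s ^- 3)%:P))).
split.
- by split=> //; [rewrite monicMl ?monicX|rewrite sPsi].
- apply: fsprod_gt0 => c rc; rewrite ltr_wpDr // normr_gt0.
  exact: (sw_class_term_neq0 s0 qroot).
- by rewrite sPsi mulrC size_mulX ?sX // -size_poly_eq0 sX.
Qed.

End SymmetricForm.

(** * Euler's q-exponential series *)

Section EulerSeries.
Variables (R : realType) (p : R).
Hypotheses (p0 : 0 < p) (p1 : p < 1).
Implicit Types x : R.

Let den_gt0 k : 0 < 1 - p * p ^+ k.
Proof. by rewrite subr_gt0 -exprS exprn_ilt1 // ltW. Qed.

Lemma qpoch_self_gt0 k : 0 < qpoch p p k.
Proof. by elim: k => [|k IHk]; rewrite ?qpoch0 // qpochS mulr_gt0. Qed.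

Definition euler_term x k : R := x ^+ k / qpoch p p k.

Lemma euler_term_ge0 x k : 0 <= x -> 0 <= euler_term x k.
Proof. by move=> x0; rewrite divr_ge0 ?exprn_ge0 // ltW ?qpoch_self_gt0. Qed.

(** The coefficient 1 - p^k picked up under x -> p x cancels the last factor of the
q-factorial, which shifts the series by one step. In the limit this is
(1 - x) E(x) = E(p x). *)
Lemma euler_partial_shift x n :
  series (euler_term x) n.+1 - series (euler_term (p * x)) n.+1 =
  x * series (euler_term x) n.
Proof.
rewrite !seriesEord -sumrB big_ord_recl mulr_sumr /euler_term !expr0 subrr add0r.
apply: eq_bigr => i _; rewrite /bump /= ?add1n exprMn qpochS.
have := qpoch_self_gt0 i; have := den_gt0 i; rewrite -exprS.
move: (p ^+ i.+1) (qpoch p p i) => P Q P1 Q0.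
by rewrite exprS; field; rewrite !gt_eqF.
Qed.

Lemma euler_partial_homo x : 0 <= x ->
  {homo series (euler_term x) : n m / (n <= m)%N >-> n <= m}.
Proof.
by move=> x0; apply/nondecreasing_series => n _ _; exact: euler_term_ge0.
Qed.

(** Small arguments are dominated by a geometric series; the functional equation
reduces every argument below 1 to such a small one. *)
Lemma euler_partial_bounded x : 0 <= x -> x < 1 ->
  exists M, forall n, series (euler_term x) n <= M.
Proof.
move=> x0 x1; have [N] : exists N, p ^+ N * x <= (1 - p) / 2.
  have [N pN] : exists N, p ^+ N <= (1 - p) / 2.
    have p2 : 0 < (1 - p) / 2 by rewrite divr_gt0 // subr_gt0.
    have : p ^+ n @[n --> \oo] --> (0 : R).
      by apply: cvg_expr; rewrite ger0_norm // ltW.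
    move=> /cvgrPdist_le /(_ _ p2) [N _ /(_ N (leqnn _))] /=.
    rewrite sub0r normrN ger0_norm ?exprn_ge0 ?(ltW p0) // => pN.
    by exists N.
  exists N; apply: le_trans pN; rewrite ler_piMr ?exprn_ge0 // ltW //.
elim: N x x0 x1 => [|N IHN] x x0 x1.
  rewrite expr0 mul1r => x2; exists 2 => n.
  suff : series (euler_term x) n <= 2 - 2 * 2^-1 ^+ n.
    by move=> /le_trans; apply; rewrite gerBl mulr_ge0 // exprn_ge0.
  elim: n => [|n IHn]; first by rewrite seriesEord /= big_ord0 expr0 mulr1 subrr.
  have tn : euler_term x n <= 2^-1 ^+ n.
    elim: n {IHn} => [|n IHn]; first by rewrite /euler_term !expr0 qpoch0 divr1.
    have -> : euler_term x n.+1 = euler_term x n * (x / (1 - p * p ^+ n)).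
      by rewrite /euler_term exprS qpochS; field; rewrite !gt_eqF // qpoch_self_gt0.
    rewrite [_^-1 ^+ n.+1]exprSr; apply: ler_pM => //.
    - exact: euler_term_ge0.
    - by rewrite divr_ge0 // ltW.
    rewrite ler_pdivrMr //.
    have : p * p ^+ n <= p by rewrite ler_piMr ?exprn_ile1 ?(ltW p0) // ltW.
    move: (p * p ^+ n) => P Pp; lra.
  by move: IHn; rewrite !seriesEnat /= !big_nat_recr //= exprS; lra.
rewrite exprSr -mulrA => /IHN[||M HM]; rewrite ?mulr_ge0 ?(ltW p0) //.
  by apply: le_lt_trans x1; rewrite ler_piMl // ltW.
exists (M / (1 - x)) => n; rewrite ler_pdivlMr ?subr_gt0 //.
have := euler_partial_shift x n; have := HM n.+1.
have := euler_partial_homo x0 (leqnSn n).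
move: (series _ _) (series _ _) (series _ _) => a b c ab cM E.
nra.
Qed.

Definition euler_sum x : R := limn (series (euler_term x)).

Lemma cvg_euler x : 0 <= x -> x < 1 -> cvgn (series (euler_term x)).
Proof.
move=> x0 x1; have [M HM] := euler_partial_bounded x0 x1.
apply: nondecreasing_is_cvgn; first exact: euler_partial_homo.
by exists M => _ [n _ <-].
Qed.

Lemma euler_sum_ge1 x : 0 <= x -> x < 1 -> 1 <= euler_sum x.
Proof.
move=> x0 x1; have := nondecreasing_cvgn_le (euler_partial_homo x0) (cvg_euler x0 x1) 1.
by rewrite {1}seriesEord /= big_ord_recl big_ord0 addr0 /euler_term expr0 qpoch0 divr1.
Qed.

Let px_ge0 x : 0 <= x -> 0 <= p * x.
Proof. by move=> x0; rewrite mulr_ge0 // ltW. Qed.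
Let px_lt1 x : 0 <= x -> x < 1 -> p * x < 1.
Proof. by move=> x0; apply: le_lt_trans; rewrite ler_piMl // ltW. Qed.

Lemma euler_shift x : 0 <= x -> x < 1 -> (1 - x) * euler_sum x = euler_sum (p * x).
Proof.
move=> x0 x1; have cx := cvg_euler x0 x1.
have cpx := cvg_euler (px_ge0 x0) (px_lt1 x0 x1).
have E : euler_sum x - euler_sum (p * x) = x * euler_sum x.
  have L1 : series (euler_term x) n.+1 - series (euler_term (p * x)) n.+1 @[n --> \oo]
      --> euler_sum x - euler_sum (p * x).
    by apply: cvgB; rewrite (cvg_shiftS (series _)).
  rewrite -(cvg_lim _ L1) //; apply: cvg_lim => //.
  under eq_cvg do rewrite euler_partial_shift.
  exact: cvgMr.
by rewrite mulrBl mul1r -E; ring.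
Qed.

Lemma qpoch_euler x N : 0 <= x -> x < 1 ->
  qpoch x p N * euler_sum x = euler_sum (p ^+ N * x).
Proof.
elim: N x => [|N IHN] x x0 x1; first by rewrite qpoch0 expr0 !mul1r.
rewrite qpochSl mulrAC euler_shift // mulrC [x * p]mulrC IHN ?px_ge0 ?px_lt1 //.
by rewrite exprSr mulrA.
Qed.

(** Euler's identity. Iterating the functional equation gives (x; p)_N E(x) = E(p^N x), and
this tends to 1 because 1 <= E(p^N x) <= 1 + p^N E(x), termwise. *)
Lemma euler_identity x : 0 <= x -> x < 1 -> qpoch x p N @[N --> \oo] --> (euler_sum x)^-1.
Proof.
move=> x0 x1; have S1 := euler_sum_ge1 x0 x1.
have S0 : euler_sum x != 0 by rewrite gt_eqF // (lt_le_trans ltr01).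
have pN0 N : 0 <= p ^+ N by rewrite exprn_ge0 // ltW.
have pN1 N : p ^+ N <= 1 by rewrite exprn_ile1 // ltW.
have L : euler_sum (p ^+ N * x) @[N --> \oo] --> (1 : R).
  apply: (@squeeze_cvgr _ _ _ _ (fun=> 1) (fun N => 1 + p ^+ N * euler_sum x)).
  - near=> N; have y0 : 0 <= p ^+ N * x by rewrite mulr_ge0.
    have y1 : p ^+ N * x < 1 by apply: le_lt_trans x1; rewrite ler_piMl.
    have le_n n : series (euler_term (p ^+ N * x)) n <= 1 + p ^+ N * series (euler_term x) n.
      rewrite !seriesEord /= mulr_sumr; case: n => [|n]; first by rewrite !big_ord0; lra.
      rewrite !big_ord_recl /= {1 3}/euler_term !expr0 qpoch0 divr1 mulr1 lerD2l.
      apply: ler_wpDl => //; apply: ler_sum => i _.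
      rewrite /euler_term mulrA ler_wpM2r ?invr_ge0 ?(ltW (qpoch_self_gt0 _)) //.
      rewrite exprMn ler_wpM2r ?exprn_ge0 // /bump /= ?add1n exprS.
      by rewrite ler_piMr // exprn_ile1.
    rewrite euler_sum_ge1 //=; apply: limr_le; first exact: cvg_euler.
    near=> n; apply: le_trans (le_n n) _.
    rewrite lerD2l ler_wpM2l //.
    exact: nondecreasing_cvgn_le (euler_partial_homo x0) (cvg_euler x0 x1) n.
  - exact: cvg_cst.
  - rewrite -[X in _ --> X]addr0; apply: cvgD; first exact: cvg_cst.
    rewrite -[X in _ --> X](mul0r (euler_sum x)); apply: cvgMl.
    by apply: cvg_expr; rewrite ger0_norm // ltW.
have -> : (fun N => qpoch x p N) = (fun N => euler_sum (p ^+ N * x) / euler_sum x).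
  by apply/funext => N; rewrite -qpoch_euler // mulfK.
by rewrite -[X in _ --> X]mul1r; apply: cvgMl.
Unshelve. all: by end_near. Qed.

Lemma qpoch_inf_euler x : 0 <= x -> x < 1 -> qpoch_inf x p * euler_sum x = 1.
Proof.
move=> x0 x1; rewrite /qpoch_inf (cvg_lim _ (euler_identity x0 x1)) //.
by rewrite mulVf // gt_eqF // (lt_le_trans ltr01) // euler_sum_ge1.
Qed.

End EulerSeries.

(** * Discrete representation *)

Lemma form_coef_sum (F : fieldType) (u : polyform F) (f : {poly F}) :
  u f = \sum_(j < size f) f`_j * moment u j.
Proof.
rewrite -[f in LHS]coefK poly_def linear_sum; apply: eq_bigr => j _.
by rewrite formZ.
Qed.

(** By linearity, convergence on the powers of x suffices. *)
Lemma is_form_series_monomials (F : numFieldType) (u : polyform F) (a : F)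
    (v : nat -> {poly F} -> F) (L : nat -> F) :
  (forall k f, v k f = \sum_(j < size f) f`_j * v k 'X^j) ->
  (forall j, series (fun k => v k 'X^j) n @[n --> \oo] --> L j) ->
  (forall j, moment u j = a * L j) ->
  is_form_series u a v.
Proof.
move=> vlin vL uL f s.
have sL : s n @[n --> \oo] --> \sum_(j < size f) f`_j * L j.
  have -> : s = (fun n => \sum_(j < size f) f`_j * series (fun k => v k 'X^j) n).
    apply/funext => n; rewrite /s seriesEord /=.
    under eq_bigr do rewrite vlin; rewrite exchange_big /=.
    by apply: eq_bigr => j _; rewrite seriesEord /= mulr_sumr.
  apply: cvg_big => [|j _]; first exact: add_continuous.
  exact: cvgMr.
split; first by apply/cvg_ex; exists (\sum_(j < size f) f`_j * L j).
rewrite (cvg_lim _ sL) // form_coef_sum mulr_sumr; apply: eq_bigr => j _.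
by rewrite uL mulrCA.
Qed.

(** In R[i] only positive reals are positive, so that a positive radius is the image of a real one. *)
Lemma cvg_complex_real (R : realType) (u : nat -> R) (l : R) :
  u n @[n --> \oo] --> l ->
  ((u n)%:C : (R[i] : numFieldType)) @[n --> \oo] --> (l%:C : (R[i] : numFieldType)).
Proof.
move=> ul; apply/cvgrPdist_le => e e0.
have [e_re e_im] : 0 < complex.Re e /\ e = (complex.Re e)%:C.
  by case: e e0 => a b; rewrite ltcE /= => /andP[/eqP -> ->].
move/cvgrPdist_le: ul => /(_ _ e_re); apply: filterS => n.
by rewrite e_im -rmorphB /= normc_def /= expr0n addr0 sqrtr_sqr lecR.
Qed.

Section RealParameters.
Variable R : realType.
Local Notation C := R[i].
Variables (q0 w0 : R).
Hypothesis q_gt0 : 0 < q0.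

Definition SW_moment n : R :=
  \prod_(k < n) (Num.sqrt q0 ^- 3 * q0 ^- k * (1 - w0 * q0 ^+ k)).

Lemma symSW_real_moment (S T : polyform C) :
  Ctilde q0%:C -> is_SW q0%:C w0%:C S -> form_sigma T =1 S ->
  forall n, moment T (2 * n) = (SW_moment n)%:C.
Proof.
move=> hq hS sigmaT n; have [S1 Srec] := (is_SW_momentP _ S hq).1 hS.
have -> : moment T (2 * n) = moment S n.
  by rewrite /moment -sigmaT /= /form_sigma_def comp_Xn_poly -exprM.
rewrite /SW_moment; elim: n => [|n IHn]; first by rewrite big_ord0 S1.
have sq : sqrtc q0%:C = (Num.sqrt q0)%:C by rewrite sqrtc_sqrtr // lecR ltW.
rewrite Srec IHn big_ord_recr sq.
by rewrite !(rmorphM, rmorphB, rmorph1, rmorphXn, fmorphV) /=; ring.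
Qed.

End RealParameters.

(** The squares of the nodes are - w q^(-k - 3/2), so that the moment of order 2 m is, up to
the factor (- w q^(-3/2))^m, the Euler series at w^-1 q^-m. Relative to its value at w^-1
this series is a finite product, by the iterated functional equation. *)
Lemma discrete_representation (R : realType) (q0 w0 : R) (S T : polyform R[i]) :
  Ctilde q0%:C -> is_SW q0%:C w0%:C S -> symmetrical T -> form_sigma T =1 S ->
  1 < q0 -> 1 < w0 ->
  let z (k : nat) : R[i] :=
    'i%C * (Num.sqrt w0 * q0 `^ (- (k%:R / 2) - 3 / 4))%:C in
  is_form_series T (qpoch_inf w0^-1 q0^-1)%:C
    (fun (k : nat) (f : {poly R[i]}) =>
      (w0 ^- k / qpoch q0^-1 q0^-1 k)%:C *
      ((horner_eval (- z k) f + horner_eval (z k) f) / 2)).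
Proof.
move=> hq hS symT sigmaT q1 w1 z.
have q_gt0 := lt_trans ltr01 q1; have w_gt0 := lt_trans ltr01 w1.
set p := q0^-1; set h := Num.sqrt q0.
have p0 : 0 < p by rewrite invr_gt0.
have p1 : p < 1 by rewrite invf_lt1.
have h0 : h != 0 by rewrite gt_eqF // sqrtr_gt0.
have x0 m : 0 <= w0^-1 * p ^+ m by rewrite mulr_ge0 ?exprn_ge0 ?invr_ge0 ?ltW.
have x1 m : w0^-1 * p ^+ m < 1.
  apply: (@le_lt_trans _ _ w0^-1); last by rewrite invf_lt1.
  by rewrite ler_piMr ?invr_ge0 ?exprn_ile1 // ltW.
have zz k : z k ^+ 2 = (- w0 * h ^- 3 * p ^+ k)%:C.
  rewrite /z exprMn sqr_i -rmorphXn /= exprMn sqr_sqrtr ?ltW //.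
  have -> : (q0 `^ (- (k%:R / 2) - 3 / 4)) ^+ 2 = p ^+ k * h ^- 3.
    rewrite -powR_mulrn ?powR_ge0 // -powRrM.
    have -> : (- (k%:R / 2) - 3 / 4) * 2 = - k%:R - 2^-1 * 3 :> R by field.
    rewrite powRD; last by rewrite (gt_eqF q_gt0) implybT.
    rewrite !powRN powR_mulrn ?ltW // powRrM powR12_sqrt ?ltW // exprVn.
    by rewrite (@powR_mulrn _ _ 3) ?sqrtr_ge0.
  by rewrite !(rmorphM, rmorphN) /=; ring.
pose L j : R[i] := if odd j then 0 else
  ((- w0 * h ^- 3) ^+ j./2 * euler_sum p (w0^-1 * p ^+ j./2))%:C.
apply: (@is_form_series_monomials _ T _ _ L).
- move=> k f; rewrite /horner_eval !horner_coef -big_split /= mulr_suml mulr_sumr.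
  by apply: eq_bigr => j _; rewrite !hornerXn; ring.
- move=> j; rewrite /L; case: ifPn => oj.
    have -> : (fun k => (w0 ^- k / qpoch p p k)%:C *
        ((horner_eval (- z k) 'X^j + horner_eval (z k) 'X^j) / 2)) = (fun=> 0 : R[i]).
      apply/funext => k; rewrite /horner_eval !hornerXn.
      by rewrite -[- z k]mulN1r exprMn -signr_odd oj expr1 mulN1r addNr mul0r mulr0.
    have -> : series (fun=> 0 : R[i]) = (fun=> 0).
      by apply/funext => n; rewrite seriesEord /= big1.
    exact: cvg_cst.
  set m := j./2; have jm : j = (2 * m)%N by rewrite -[LHS]odd_double_half (negbTE oj) mul2n.
  have -> : series (fun k => (w0 ^- k / qpoch p p k)%:C *
        ((horner_eval (- z k) 'X^j + horner_eval (z k) 'X^j) / 2)) =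
     (fun n => ((- w0 * h ^- 3) ^+ m * series (euler_term p (w0^-1 * p ^+ m)) n)%:C).
    apply/funext => n; rewrite !seriesEord /= mulr_sumr rmorph_sum.
    apply: eq_bigr => k _; rewrite /horner_eval !hornerXn jm !exprM sqrrN zz.
    rewrite -rmorphXn /= [X in _ * X](_ : _ = ((- w0 * h ^- 3 * p ^+ k) ^+ m)%:C); last first.
      by field.
    rewrite -rmorphM /=; congr (_ %:C); rewrite /euler_term.
    have -> : (w0^-1 * p ^+ m) ^+ k = w0 ^- k * (p ^+ k) ^+ m.
      by rewrite exprMn exprVn -!exprM mulnC.
    by rewrite [(- w0 * h ^- 3 * _) ^+ m]exprMn; ring.
  apply: cvg_complex_real; apply: cvgMr; exact: cvg_euler.
- move=> j; rewrite /L; case: ifPn => oj.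
    by rewrite mulr0 -[j]odd_double_half oj add1n symT.
  set m := j./2; have jm : j = (2 * m)%N by rewrite -[LHS]odd_double_half (negbTE oj) mul2n.
  rewrite jm (symSW_real_moment q_gt0 hq hS sigmaT) -rmorphM /=; congr (_%:C).
  have qe : qpoch w0^-1 p m * euler_sum p w0^-1 = euler_sum p (w0^-1 * p ^+ m).
    rewrite qpoch_euler // ?invr_ge0 ?ltW ?invf_lt1 // mulrC //.
  have -> : qpoch_inf w0^-1 p * ((- w0 * h ^- 3) ^+ m * euler_sum p (w0^-1 * p ^+ m)) =
      (- w0 * h ^- 3) ^+ m * qpoch w0^-1 p m * (qpoch_inf w0^-1 p * euler_sum p w0^-1).
    by rewrite -qe; ring.
  rewrite qpoch_inf_euler ?invr_ge0 ?invf_lt1 ?(ltW w_gt0) // mulr1.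
  rewrite /SW_moment -/h qpoch_prod.
  have -> : (- w0 * h ^- 3) ^+ m = \prod_(k < m) (- w0 * h ^- 3).
    by rewrite prodr_const card_ord.
  rewrite -big_split; apply: eq_bigr => k _ /=; rewrite /p exprVn.
  by field; rewrite h0 expf_neq0 ?gt_eqF.
Qed.

(** * Exponential substitution and even weights *)

Section ExponentialSubstitution.
Variable R : realType.
Local Notation mu := (@lebesgue_measure R).
Implicit Types (G V : R -> R) (x t : R).

Let box n : set R := `[expR (- n%:R), expR n%:R]%classic.

Let box_gt0 n x : box n x -> 0 < x.
Proof. by rewrite /box /= in_itv /= => /andP[ex _]; exact: lt_le_trans (expR_gt0 _) ex. Qed.

Let box_homo m n : (m <= n)%N -> box m `<=` box n.
Proof.
move=> mn x; rewrite /box /= !in_itv /= => /andP[mx xm].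
by apply/andP; split; [apply: le_trans mx|apply: le_trans xm _];
  rewrite ler_expR ?lerN2 ler_nat.
Qed.

Let bigcup_box : \bigcup_n box n = `]0, +oo[%classic.
Proof.
apply/seteqP; split=> x; first by move=> [n _ /box_gt0 x0]; rewrite /= in_itv /= x0.
rewrite /= in_itv /= andbT => x0.
have [n xn] : exists n, `|ln x| <= n%:R :> R.
  by exists (Num.bound `|ln x|); rewrite ltW // archi_boundP.
exists n => //; rewrite /box /= in_itv /= -{1 2}(lnK x0) !ler_expR.
by rewrite -ler_norml.
Qed.

Let bigcup_interval : \bigcup_n `[- n%:R, n%:R]%classic = [set: R].
Proof.
apply/seteqP; split=> // x _; exists (Num.bound `|x|) => //=.
by rewrite in_itv /= -ler_norml ltW // archi_boundP.
Qed.

Let continuous_measurable_pos G : {in `]0, +oo[, continuous G} ->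
  measurable_fun (`]0%R, +oo[ : set R) G.
Proof.
move=> cG; apply: open_continuous_measurable_fun; first exact: interval_open.
by move=> x; rewrite inE /= => x0; exact: cG.
Qed.

(** Substitution on the segments [-n, n], on which the derivative of exp is bounded,
followed by monotone exhaustion. *)
Lemma ge0_integral_expR_subst G : {in `]0, +oo[, continuous G} ->
  {in `]0, +oo[, forall x, 0 <= G x} ->
  (\int[mu]_(x in `]0%R, +oo[) (G x)%:E = \int[mu]_t (G (expR t) * expR t)%R%:E)%E.
Proof.
move=> cG G0; have ge0 t : expR t \in `]0, +oo[ by rewrite in_itv /= expR_gt0.
have cGe : continuous (fun t => G (expR t) * expR t).
  move=> t; apply: cvgM; last exact: continuous_expR.
  by apply: continuous_comp; [exact: continuous_expR|exact: cG].
have L1 : (\int[mu]_(x in box n) (G x)%:E @[n --> \oo] -->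
    \int[mu]_(x in `]0%R, +oo[) (G x)%:E)%E.
  rewrite -bigcup_box; apply: ge0_nondecreasing_set_cvg_integral.
  - by move=> m n mn; rewrite subsetEset; exact: box_homo.
  - by move=> n; exact: measurable_itv.
  - move=> n; apply/measurable_EFinP.
    apply: measurable_funS (continuous_measurable_pos cG); first exact: measurable_itv.
    by rewrite -bigcup_box; exact: bigcup_sup.
  - by move=> n x /box_gt0 x0; rewrite lee_fin G0 // in_itv /= x0.
have L2 : (\int[mu]_(t in `[(- n%:R)%R, n%:R]) (G (expR t) * expR t)%R%:E @[n --> \oo] -->
    \int[mu]_t (G (expR t) * expR t)%R%:E)%E.
  rewrite -bigcup_interval; apply: ge0_nondecreasing_set_cvg_integral.
  - move=> m n mn; rewrite subsetEset; apply: subset_itv; rewrite bnd_simp ?lerN2 ler_nat //.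
  - by move=> n; exact: measurable_itv.
  - move=> n; apply/measurable_EFinP; apply: measurable_funTS.
    exact: continuous_measurable_fun.
  - by move=> n t _; rewrite lee_fin mulr_ge0 ?expR_ge0 ?G0.
have dE : derive1 (@expR R) = expR by apply/funext => t; rewrite derive1E derive_val.
apply: (cvg_unique _ L1); first exact: ereal_hausdorff.
apply: cvg_trans L2; apply: near_eq_cvg; near=> n.
rewrite /box integration_by_substitution_increasing ?dE //.
- by rewrite ge0_cp // ?oppr_le0.
- by move=> x y _ _ xy; rewrite ltr_expR.
- by move=> x _; exact: continuous_expR.
- by apply: cvgP; apply: cvg_at_right_filter; exact: continuous_expR.
- by apply: cvgP; apply: cvg_at_left_filter; exact: continuous_expR.
- split=> //; [apply: cvg_at_right_filter|apply: cvg_at_left_filter]; exact: continuous_expR.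
- apply: continuous_in_subspaceT => x; rewrite inE /= => xn; apply: cG.
  by rewrite in_itv /= (box_gt0 xn).
Unshelve. all: by end_near. Qed.

Lemma ge0_integral_oppr G : {in `]-oo, 0[, continuous G} ->
  {in `]-oo, 0[, forall x, 0 <= G x} ->
  (\int[mu]_(x in `]-oo, 0%R[) (G x)%:E = \int[mu]_(x in `]0%R, +oo[) (G (- x)%R)%:E)%E.
Proof.
move=> cG G0; pose nbox n : set R := `[- expR n%:R, - expR (- n%:R)]%classic.
have nboxN n x : nbox n x = box n (- x).
  by rewrite /nbox /box /= !in_itv /= lerNr [- x <= _]lerNl andbC.
have N0 x : 0 < x -> - x \in `]-oo, 0[ by move=> x0; rewrite in_itv /= oppr_lt0.
have bigcup_nbox : \bigcup_n nbox n = `]-oo, 0[%classic.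
  apply/seteqP; split=> x.
    move=> [n _]; rewrite nboxN => /box_gt0 x0.
    by rewrite /= in_itv /= -oppr_gt0.
  rewrite /= in_itv /= -oppr_gt0 => x0.
  have : (\bigcup_n box n) (- x) by rewrite bigcup_box /= in_itv /= x0.
  by move=> [n _ bx]; exists n => //; rewrite nboxN.
have mG : measurable_fun (`]-oo, 0[ : set R) G.
  apply: open_continuous_measurable_fun; first exact: interval_open.
  by move=> x; rewrite inE /= => x0; exact: cG.
have L1 : (\int[mu]_(x in nbox n) (G x)%:E @[n --> \oo] -->
    \int[mu]_(x in `]-oo, 0%R[) (G x)%:E)%E.
  rewrite -bigcup_nbox; apply: ge0_nondecreasing_set_cvg_integral.
  - by move=> m n mn; rewrite subsetEset => x; rewrite !nboxN; exact: box_homo.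
  - by move=> n; exact: measurable_itv.
  - move=> n; apply/measurable_EFinP.
    apply: measurable_funS mG; first exact: measurable_itv.
    by rewrite -bigcup_nbox; exact: bigcup_sup.
  - by move=> n x; rewrite nboxN => /box_gt0 /N0; rewrite opprK lee_fin => /G0.
have cGN : {in `]0, +oo[, continuous (fun x => G (- x))}.
  move=> x; rewrite in_itv /= andbT => x0.
  by apply: continuous_comp; [exact: opp_continuous|exact/cG/N0].
have L2 : (\int[mu]_(x in box n) (G (- x)%R)%:E @[n --> \oo] -->
    \int[mu]_(x in `]0%R, +oo[) (G (- x)%R)%:E)%E.
  rewrite -bigcup_box; apply: ge0_nondecreasing_set_cvg_integral.
  - by move=> m n mn; rewrite subsetEset; exact: box_homo.
  - by move=> n; exact: measurable_itv.
  - move=> n; apply/measurable_EFinP.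
    apply: measurable_funS (continuous_measurable_pos cGN); first exact: measurable_itv.
    by rewrite -bigcup_box; exact: bigcup_sup.
  - by move=> n x /box_gt0 /N0 x0; rewrite lee_fin G0.
apply: (cvg_unique _ L1); first exact: ereal_hausdorff.
apply: cvg_trans L2; apply: near_eq_cvg; near=> n.
rewrite /nbox /box integration_by_substitution_oppr //.
- by rewrite ler_expR ge0_cp // ?oppr_le0.
- apply: continuous_in_subspaceT => x; rewrite inE /= => xn; apply: cG.
  by rewrite -[x]opprK N0 //; apply: (@box_gt0 n); rewrite -nboxN.
Unshelve. all: by end_near. Qed.

(** Continuity is asked away from the origin, where the weights |x|^(2 p - 1) with small p
blow up. The two half-lines contribute J and (-1)^n J. *)
Lemma even_weight_moment V (J : R) n :
  {in `]0, +oo[, continuous V} -> {in `]0, +oo[, forall x, 0 <= V x} ->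
  (\int[mu]_t (V (expR t) * expR t ^+ n.+1)%R%:E = J%:E)%E ->
  mu.-integrable setT (EFin \o (fun x => V `|x| * x ^+ n)) /\
  \int[mu]_x (V `|x| * x ^+ n) = (1 + (-1) ^+ n) * J.
Proof.
move=> cV V0 VJ; set h := fun x => V `|x| * x ^+ n.
set N : set R := `]-oo, 0[%classic; set P : set R := `]0, +oo[%classic.
have mN : measurable N by exact: measurable_itv.
have mP : measurable P by exact: measurable_itv.
have hP x : x \in `]0, +oo[ -> h x = V x * x ^+ n.
  by rewrite in_itv /= andbT => x0; rewrite /h gtr0_norm.
have hN x : x \in `]-oo, 0[ -> h x = V (- x) * x ^+ n.
  by rewrite in_itv /= => x0; rewrite /h ltr0_norm.
have cVn : {in `]0, +oo[, continuous (fun x => V x * x ^+ n)}.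
  by move=> x x0; apply: cvgM; [exact: cV|exact: exprn_continuous].
have Vn0 : {in `]0, +oo[, forall x, 0 <= V x * x ^+ n}.
  move=> x xP; rewrite mulr_ge0 ?V0 // exprn_ge0 //.
  by move: xP; rewrite in_itv /= andbT => /ltW.
have IP : (\int[mu]_(x in P) (h x)%:E = J%:E)%E.
  rewrite -VJ; transitivity (\int[mu]_t (V (expR t) * expR t ^+ n * expR t)%R%:E)%E.
    rewrite -[RHS](ge0_integral_expR_subst cVn Vn0); apply: eq_integral => x.
    by rewrite inE /= => xP; rewrite hP.
  by apply: eq_integral => t _; rewrite exprSr mulrA.
have Nsub x : x \in `]-oo, 0[ -> - x \in `]0, +oo[.
  by rewrite !in_itv /= andbT oppr_gt0.
have cN : {in `]-oo, 0[, continuous (fun x => V (- x) * (- x) ^+ n)}.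
  move=> x xN; have := cVn _ (Nsub _ xN).
  by apply: continuous_comp; exact: opp_continuous.
have INabs : (\int[mu]_(x in N) (V (- x) * (- x) ^+ n)%R%:E = J%:E)%E.
  rewrite (ge0_integral_oppr cN); last by move=> x xN; apply: Vn0; exact: Nsub.
  by rewrite -IP; apply: eq_integral => x; rewrite inE /= opprK => xP; rewrite hP.
have mhP : measurable_fun P h.
  apply: (@eq_measurable_fun _ _ _ _ _ (fun x => V x * x ^+ n)).
    by move=> x; rewrite inE => xP; rewrite hP.
  exact: continuous_measurable_pos.
have mhNa : measurable_fun N (fun x => V (- x) * (- x) ^+ n).
  apply: open_continuous_measurable_fun; first exact: interval_open.
  by move=> x; rewrite inE /= => x0; exact: cN.
have hNa x : x \in `]-oo, 0[ -> h x = (-1) ^+ n * (V (- x) * (- x) ^+ n).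
  by move=> xN; rewrite hN // mulrCA -exprMn mulN1r opprK.
have mhN : measurable_fun N h.
  apply: (@eq_measurable_fun _ _ _ _ _ (fun x => (-1) ^+ n * (V (- x) * (- x) ^+ n))).
    by move=> x; rewrite inE => xN; rewrite hNa.
  exact: measurable_funM.
have NP : [set: R] `\ 0 = N `|` P.
  apply/seteqP; split=> x; rewrite /N /P /= !in_itv /= andbT.
    by move=> [_ /eqP x0]; apply/orP; rewrite -neq_lt.
  by move=> xNP; split=> // x0; move: xNP; rewrite x0 ltxx; case.
have NPd : [disjoint N & P].
  apply/disj_setPS => x [] /=; rewrite /N /P /= !in_itv /= andbT => x0 x1.
  by have := lt_trans x0 x1; rewrite ltxx.
have mh0 : measurable_fun ([set: R] `\ 0) h by rewrite NP; apply/measurable_funU.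
have mh : measurable_fun [set: R] h.
  rewrite -(@setD1K _ 0 [set: R]) //; apply/measurable_funU => //.
    by rewrite NP; exact: measurableU.
  by split=> //; exact: measurable_fun_set1.
have splitR (g : R -> \bar R) : measurable_fun [set: R] g ->
    (\int[mu]_x g x = \int[mu]_(x in N) g x + \int[mu]_(x in P) g x)%E.
  move=> mg; rewrite -(@integral_setD1 _ g 0 [set: R]); last 2 first.
  - by rewrite NP; exact: measurableU.
  - exact: measurable_funTS.
  by rewrite NP integral_setU //; exact: measurable_funTS.
have IN : (\int[mu]_(x in N) (h x)%:E = ((-1) ^+ n * J)%:E)%E.
  rewrite EFinM -INabs -integralZl //; last first.
    apply/integrableP; split; first exact/measurable_EFinP.
    under eq_integral => x.
      rewrite inE => xN; rewrite /= ger0_norm; last by apply: Vn0; exact: Nsub.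
      over.
    by rewrite INabs ltry.
  apply: eq_integral => x; rewrite inE => xN.
  by rewrite hNa // EFinM.
split; last first.
  rewrite /Rintegral splitR ?IN ?IP; last exact/measurable_EFinP.
  by rewrite /= mulrDl mul1r addrC.
apply/integrableP; split; first exact/measurable_EFinP.
rewrite splitR; last by apply/measurable_EFinP/measurableT_comp.
have -> : (\int[mu]_(x in P) `|(EFin \o h) x| = J%:E)%E.
  rewrite -IP; apply: eq_integral => x; rewrite inE => xP /=.
  by rewrite ger0_norm // hP // Vn0.
have -> : (\int[mu]_(x in N) `|(EFin \o h) x| = J%:E)%E.
  rewrite -INabs; apply: eq_integral => x; rewrite inE => xN /=.
  by rewrite hNa // normrM normrX normrN1 expr1n mul1r ger0_norm // Vn0 ?Nsub.
by rewrite -EFinD ltry.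
Qed.

End ExponentialSubstitution.

(** * The infinite product on the positive half-line *)

Section InfiniteProduct.
Variables (R : realType) (q : R).
Hypotheses (q0 : 0 < q) (q1 : q < 1).
Implicit Types x y : R.

Let P n y := qpoch (- y) q n.

Let qn_ge0 n : 0 <= q ^+ n.
Proof. by rewrite exprn_ge0 // ltW. Qed.

Let PS n y : P n.+1 y = P n y * (1 + y * q ^+ n).
Proof. by rewrite /P qpochS mulNr opprK. Qed.

Let factor_ge1 n y : 0 <= y -> 1 <= 1 + y * q ^+ n.
Proof. by move=> y0; rewrite lerDl mulr_ge0. Qed.

Let P_ge1 n y : 0 <= y -> 1 <= P n y.
Proof.
move=> y0; elim: n => [|n IHn]; first by rewrite /P qpoch0.
by rewrite PS -[leLHS]mulr1 ler_pM // factor_ge1.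
Qed.

Let P_gt0 n y : 0 <= y -> 0 < P n y.
Proof. by move=> y0; rewrite (lt_le_trans ltr01) ?P_ge1. Qed.

Let P_homo y : 0 <= y -> {homo P^~ y : m n / (m <= n)%N >-> m <= n}.
Proof.
move=> y0; apply/nondecreasing_seqP => n /=; rewrite PS ler_peMr ?factor_ge1 //.
exact: ltW (P_gt0 n y0).
Qed.

Let geom n : \sum_(k < n) q ^+ k <= (1 - q)^-1.
Proof.
have := @geometric_le_lim R n 1 q ler01 q0; rewrite (ger0_norm (ltW q0)) => /(_ q1).
rewrite mul1r seriesEord; apply: le_trans.
by rewrite le_eqVlt; apply/orP; left; apply/eqP; apply: eq_bigr => k _ /=; rewrite mul1r.
Qed.

Let P_le_expR n y : 0 <= y -> P n y <= expR (y / (1 - q)).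
Proof.
move=> y0; apply: (@le_trans _ _ (expR (y * \sum_(k < n) q ^+ k))); last first.
  by rewrite ler_expR ler_wpM2l.
elim: n => [|n IHn]; first by rewrite big_ord0 mulr0 expR0 /P qpoch0.
rewrite PS big_ord_recr /= [y * (_ + _)]mulrDr expRD.
apply: ler_pM IHn (expR_ge1Dx _); first exact: ltW (P_gt0 n y0).
by rewrite (le_trans ler01) // factor_ge1.
Qed.

Lemma cvg_qpochN y : 0 <= y -> qpoch (- y) q n @[n --> \oo] --> qpoch_inf (- y) q.
Proof.
move=> y0; apply: nondecreasing_is_cvgn; first exact: P_homo.
by exists (expR (y / (1 - q))) => _ [n _ <-]; exact: P_le_expR.
Qed.

Lemma qpoch_infN_ge n y : 0 <= y -> qpoch (- y) q n <= qpoch_inf (- y) q.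
Proof.
by move=> y0; apply: (nondecreasing_cvgn_le (P_homo y0)); apply: cvgP (cvg_qpochN y0).
Qed.

Lemma qpoch_infN_ge1 y : 0 <= y -> 1 <= qpoch_inf (- y) q.
Proof. by move=> y0; apply: le_trans (qpoch_infN_ge 0 y0); rewrite qpoch0. Qed.

Lemma qpoch_infN_gt0 y : 0 <= y -> 0 < qpoch_inf (- y) q.
Proof. by move=> y0; rewrite (lt_le_trans ltr01) // qpoch_infN_ge1. Qed.

Lemma qpoch_infN_shift y : 0 <= y ->
  qpoch_inf (- y) q = (1 + y) * qpoch_inf (- (q * y)) q.
Proof.
move=> y0; have qy0 : 0 <= q * y by rewrite mulr_ge0 // ltW.
have L1 : qpoch (- y) q n.+1 @[n --> \oo] --> qpoch_inf (- y) q.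
  by rewrite (cvg_shiftS (qpoch (- y) q)); exact: cvg_qpochN.
rewrite -(cvg_lim _ L1) //; apply: cvg_lim => //.
under eq_cvg do rewrite qpochSl opprK mulNr [y * q]mulrC.
by apply: cvgMr; exact: cvg_qpochN.
Qed.

(** Each factor 1 / (1 + y q^k) is q^k-Lipschitz with values in ]0, 1], so the
product inherits the sum of the Lipschitz constants. *)
Let inv_P_lipschitz n x y : 0 <= x -> x <= y ->
  0 <= (P n x)^-1 - (P n y)^-1 <= (\sum_(k < n) q ^+ k) * (y - x).
Proof.
move=> x0 xy; have y0 := le_trans x0 xy.
elim: n => [|n /andP[IH0 IH1]].
  by rewrite /P !qpoch0 big_ord0 subrr mul0r lexx.
rewrite !PS big_ord_recr /= !invfM mulrDl.
have b0 z : 0 <= z -> 0 <= (1 + z * q ^+ n)^-1 <= 1.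
  move=> z0; have z1 := factor_ge1 n z0.
  by rewrite invr_ge0 (le_trans ler01 z1) /= invf_le1 // (lt_le_trans ltr01 z1).
have a0 z : 0 <= z -> 0 <= (P n z)^-1 <= 1.
  by move=> z0; rewrite invr_ge0 (ltW (P_gt0 n z0)) /= invf_le1 ?P_gt0 ?P_ge1.
have bb : 0 <= (1 + x * q ^+ n)^-1 - (1 + y * q ^+ n)^-1 <= q ^+ n * (y - x).
  have x1 := factor_ge1 n x0; have y1 := factor_ge1 n y0.
  have -> : (1 + x * q ^+ n)^-1 - (1 + y * q ^+ n)^-1 =
      q ^+ n * (y - x) * ((1 + x * q ^+ n)^-1 * (1 + y * q ^+ n)^-1).
    by field; rewrite !gt_eqF // (lt_le_trans ltr01).
  have d0 : 0 <= q ^+ n * (y - x) by rewrite mulr_ge0 // subr_ge0.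
  have /andP[bx0 bx1] := b0 _ x0; have /andP[by0 by1] := b0 _ y0.
  apply/andP; split; first exact: mulr_ge0 d0 (mulr_ge0 bx0 by0).
  by rewrite (ler_piMr d0) // mulr_ile1.
move: (a0 _ x0) (b0 _ y0) bb IH0 IH1 => /andP[].
move: (P n x)^-1 (P n y)^-1 (1 + x * q ^+ n)^-1 (1 + y * q ^+ n)^-1 => a a' b b'.
move=> a_0 a_1 /andP[b_0 b_1] /andP[bb0 bb1] aa0 aa1.
have -> : a * b - a' * b' = (a - a') * b' + a * (b - b') by ring.
apply/andP; split; first by rewrite addr_ge0 // mulr_ge0.
apply: lerD.
  by apply: le_trans aa1; rewrite ler_piMr.
by apply: le_trans bb1; rewrite ler_piMl.
Qed.

Let inv_qpoch_inf_lipschitz x y : 0 <= x -> x <= y ->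
  0 <= (qpoch_inf (- x) q)^-1 - (qpoch_inf (- y) q)^-1 <= (1 - q)^-1 * (y - x).
Proof.
move=> x0 xy; have y0 := le_trans x0 xy.
have L : (P n x)^-1 - (P n y)^-1 @[n --> \oo] -->
    (qpoch_inf (- x) q)^-1 - (qpoch_inf (- y) q)^-1.
  apply: cvgB; (apply: cvgV; last exact: cvg_qpochN);
    by rewrite gt_eqF // qpoch_infN_gt0.
apply/andP; split.
  by apply: (cvgr_to_ge L); near=> n; have /andP[] := inv_P_lipschitz n x0 xy.
apply: (cvgr_to_le L); near=> n; have /andP[_ /le_trans] := inv_P_lipschitz n x0 xy.
by apply; rewrite ler_wpM2r // subr_ge0.
Unshelve. all: by end_near. Qed.

Lemma continuous_inv_qpoch_inf y : 0 < y ->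
  {for y, continuous (fun z => (qpoch_inf (- z) q)^-1)}.
Proof.
move=> y0; apply/cvgrPdist_le => e e0.
have c0 : 0 < (1 - q)^-1 by rewrite invr_gt0 subr_gt0.
near=> z.
have z0 : 0 <= z by rewrite ltW //; near: z; apply: (cvgr_gt y) => //; exact: cvg_id.
have zy : (1 - q)^-1 * `|y - z| <= e.
  rewrite mulrC ler_pdivrMr ?subr_gt0 //; near: z.
  by apply: cvgr_dist_le; [exact: cvg_id|rewrite mulr_gt0 // subr_gt0].
apply: le_trans zy; have [yz|/ltW zy] := leP y z.
  have /andP[h0 h1] := inv_qpoch_inf_lipschitz (ltW y0) yz.
  by rewrite ger0_norm // distrC ger0_norm // subr_ge0.
have /andP[h0 h1] := inv_qpoch_inf_lipschitz z0 zy.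
by rewrite distrC ger0_norm // ger0_norm // subr_ge0.
Unshelve. all: by end_near. Qed.

(** The first N factors alone bound the product below by a multiple of y^N. *)
Lemma inv_qpoch_inf_decay N : exists2 M, 0 <= M &
  forall y, 0 < y -> (qpoch_inf (- y) q)^-1 <= M * y ^- N.
Proof.
pose c := \prod_(k < N) q ^+ k.
have c0 : 0 < c by apply: prodr_gt0 => k _; rewrite exprn_gt0.
exists c^-1 => [|y y0]; first by rewrite invr_ge0 ltW.
rewrite -invfM lef_pV2 ?posrE ?qpoch_infN_gt0 ?mulr_gt0 ?exprn_gt0 ?(ltW y0) //.
apply: le_trans (qpoch_infN_ge N (ltW y0)); rewrite qpoch_prod.
have -> : c * y ^+ N = \prod_(k < N) (y * q ^+ k).
  by rewrite big_split /= prodr_const card_ord mulrC.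
apply: ler_prod => k _; rewrite mulr_ge0 ?(ltW y0) //= mulNr opprK.
by rewrite lerDr.
Qed.

Lemma qpoch_infN_homo x y : 0 <= x -> x <= y -> qpoch_inf (- x) q <= qpoch_inf (- y) q.
Proof.
move=> x0 xy; have /andP[+ _] := inv_qpoch_inf_lipschitz x0 xy.
by rewrite subr_ge0 lef_pV2 ?posrE ?qpoch_infN_gt0 // (le_trans x0).
Qed.

End InfiniteProduct.

(** * Integral representations *)

Section IntegralRepresentation.
Variable R : realType.
Local Notation mu := (@lebesgue_measure R).
Local Notation C := R[i].

Lemma Rintegral_lincomb (g : nat -> R -> R) (a : nat -> R) n :
  (forall j, mu.-integrable setT (EFin \o g j)) ->
  mu.-integrable setT (EFin \o (fun x => \sum_(j < n) a j * g j x)) /\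
  \int[mu]_x (\sum_(j < n) a j * g j x) = \sum_(j < n) a j * \int[mu]_x g j x.
Proof.
move=> ig; have iag j : mu.-integrable setT (EFin \o (fun x => a j * g j x)).
  have -> : EFin \o (fun x => a j * g j x) = (fun x => (a j)%:E * (EFin \o g j) x)%E.
    by apply/funext => x /=; rewrite EFinM.
  exact: integrableZl.
elim: n => [|n [IHi IHn]].
  have -> : (fun x : R => \sum_(j < 0) a j * g j x) = cst 0.
    by apply/funext => x; rewrite big_ord0.
  by split; [exact: integrable0|rewrite big_ord0 /Rintegral integral0].
have -> : (fun x : R => \sum_(j < n.+1) a j * g j x) =
    (fun x => (\sum_(j < n) a j * g j x) + a n * g n x).
  by apply/funext => x; rewrite big_ord_recr.
split.
  have -> : EFin \o (fun x => (\sum_(j < n) a j * g j x) + a n * g n x) =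
     ((EFin \o (fun x => (\sum_(j < n) a j * g j x)%R)) \+ (EFin \o (fun x => (a n * g n x)%R)))%E.
    by apply/funext => x /=; rewrite EFinD.
  exact: integrableD.
by rewrite RintegralD // IHn RintegralZl // big_ord_recr.
Qed.

Lemma integral_representation (T : polyform C) (W : R -> R) (K : R) :
  (forall n, mu.-integrable setT (EFin \o (fun x => W x * x ^+ n))) ->
  (forall n, moment T n = (K * \int[mu]_x (W x * x ^+ n))%:C) ->
  forall f : {poly C},
    Cintegrable (fun x : R => (W x)%:C * f.[x%:C]) /\
    T f = K%:C * Cintegral (fun x : R => (W x)%:C * f.[x%:C]).
Proof.
move=> iW mT f; set n := size f.
have ReD (z1 z2 : C) : complex.Re (z1 + z2) = complex.Re z1 + complex.Re z2.
  by case: z1 z2 => ? ? [].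
have ImD (z1 z2 : C) : complex.Im (z1 + z2) = complex.Im z1 + complex.Im z2.
  by case: z1 z2 => ? ? [].
have E x : (W x)%:C * f.[x%:C] = \sum_(j < n) f`_j * (W x * x ^+ j)%:C.
  rewrite horner_coef mulr_sumr; apply: eq_bigr => j _.
  by rewrite rmorphM rmorphXn /=; ring.
have ReM (z : C) r : complex.Re (z * r%:C) = complex.Re z * r.
  by case: z => a b /=; rewrite mulr0 subr0.
have ImM (z : C) r : complex.Im (z * r%:C) = complex.Im z * r.
  by case: z => a b /=; rewrite mulr0 add0r.
have ReE : (fun x => complex.Re ((W x)%:C * f.[x%:C])) =
    (fun x => \sum_(j < n) complex.Re f`_j * (W x * x ^+ j)).
  apply/funext => x; rewrite E (big_morph (@complex.Re R) ReD (erefl _)).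
  by apply: eq_bigr => j _; rewrite ReM.
have ImE : (fun x => complex.Im ((W x)%:C * f.[x%:C])) =
    (fun x => \sum_(j < n) complex.Im f`_j * (W x * x ^+ j)).
  apply/funext => x; rewrite E (big_morph (@complex.Im R) ImD (erefl _)).
  by apply: eq_bigr => j _; rewrite ImM.
have [iRe vRe] := Rintegral_lincomb (fun j => complex.Re f`_j) n iW.
have [iIm vIm] := Rintegral_lincomb (fun j => complex.Im f`_j) n iW.
split; first by split; rewrite ?ReE ?ImE.
rewrite /Cintegral ReE ImE vRe vIm form_coef_sum -/n.
apply/eqP; rewrite eq_complex; apply/andP; split; apply/eqP.
  rewrite (big_morph (@complex.Re R) ReD (erefl _)) /= mul0r subr0 mulr_sumr.
  by apply: eq_bigr => j _; rewrite mT ReM mulrCA.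
rewrite (big_morph (@complex.Im R) ImD (erefl _)) /= mul0r addr0 mulr_sumr.
by apply: eq_bigr => j _; rewrite mT ImM mulrCA.
Qed.

End IntegralRepresentation.

Section EvenWeights.
Variable R : realType.
Local Notation mu := (@lebesgue_measure R).
Local Notation C := R[i].

(** Here J n is the n-th moment of V on the half-line; evenness doubles it. *)
Lemma even_weight_representation (T : polyform C) (V : R -> R) (J : nat -> R) (K : R) :
  symmetrical T ->
  {in `]0, +oo[, continuous V} -> {in `]0, +oo[, forall x, 0 <= V x} ->
  (forall n, (\int[mu]_t (V (expR t) * expR t ^+ n.+1)%R%:E = (J n)%:E)%E) ->
  (forall n, moment T (2 * n) = (K * (2 * J (2 * n)%N))%:C) ->
  forall f : {poly C},
    Cintegrable (fun x : R => (V `|x|)%:C * f.[x%:C]) /\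
    T f = K%:C * Cintegral (fun x : R => (V `|x|)%:C * f.[x%:C]).
Proof.
move=> sT cV V0 VJ mT; apply: integral_representation => n.
  by have [] := even_weight_moment cV V0 (VJ n).
have [_ ->] := even_weight_moment cV V0 (VJ n).
rewrite -signr_odd; have [on|en] := boolP (odd n).
  by rewrite expr1 subrr mul0r mulr0 -[n]odd_double_half on add1n sT.
have En : n = (2 * n./2)%N by rewrite -[LHS]odd_double_half (negbTE en) mul2n.
by rewrite [in LHS]En mT -En expr0.
Qed.

(** The Gaussian integral, read off from the normalization of the normal density. *)
Lemma integral_normal_fun (m s : R) : s != 0 ->
  (\int[mu]_x (expR (- (x - m) ^+ 2 / (s ^+ 2 *+ 2)))%:E =
   (Num.sqrt (s ^+ 2 * pi *+ 2))%:E)%E.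
Proof.
move=> s0; have peak0 := normal_peak_gt0 s0.
transitivity (\int[mu]_x ((Num.sqrt (s ^+ 2 * pi *+ 2))%:E * (normal_pdf m s x)%:E))%E.
  apply: eq_integral => x _; rewrite normal_pdfE // -EFinM mulrA.
  rewrite /normal_peak divff ?mul1r //.
  by move: peak0; rewrite /normal_peak invr_gt0 => /gt_eqF ->.
rewrite integralZl //; last exact: integrable_normal_pdf.
by rewrite integral_normal_pdf mule1.
Qed.

(** Under x = e^t the weight becomes a Gaussian in t; the n-th moment shifts its centre,
and completing the square produces the power of q. *)
Lemma lognormal_moment (L : R) n : 0 < L ->
  (\int[mu]_t (expR t * expR (- 2 * ln (expR t) ^+ 2 / L) * expR t ^+ n.+1)%R%:E =
   (expR (n.+2%:R ^+ 2 * L / 8) * Num.sqrt (pi * L / 2))%:E)%E.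
Proof.
move=> L0; have s0 : Num.sqrt L / 2 != 0 by rewrite gt_eqF // divr_gt0 // sqrtr_gt0.
have s2 : (Num.sqrt L / 2) ^+ 2 = L / 4.
  by rewrite expr_div_n sqr_sqrtr ?(ltW L0) //; congr (_ / _); ring.
transitivity (\int[mu]_t ((expR (n.+2%:R ^+ 2 * L / 8))%:E *
    (expR (- (t - n.+2%:R * L / 4) ^+ 2 / ((Num.sqrt L / 2) ^+ 2 *+ 2)))%:E))%E.
  apply: eq_integral => t _; rewrite -EFinM -!expRM_natl -!expRD s2 expRK; congr (expR _)%:E.
  have L1 : L != 0 by rewrite gt_eqF.
  by rewrite -[n.+2]addn1 -[n.+1 in LHS]addn0 !natrD; field.
rewrite ge0_integralZl_EFin //.
- by rewrite integral_normal_fun // s2 -EFinM; congr (_ * Num.sqrt _)%:E; field.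
- by apply/measurable_EFinP; exact: measurable_normal_fun.
Qed.

End EvenWeights.

Lemma lognormal_representation (R : realType) (q0 : R) (S T : polyform R[i]) :
  Ctilde q0%:C -> is_SW q0%:C 0%:C S -> symmetrical T -> form_sigma T =1 S ->
  0 < q0 -> q0 < 1 ->
  let W (x : R) := `|x| * expR (- 2 * ln `|x| ^+ 2 / ln q0^-1) in
  forall f : {poly R[i]},
    Cintegrable (fun x : R => (W x)%:C * f.[x%:C]) /\
    T f = (Num.sqrt (q0 / (2 * pi * ln q0^-1)))%:C *
          Cintegral (fun x : R => (W x)%:C * f.[x%:C]).
Proof.
move=> hq hS symT sigmaT q_gt0 q_lt1 W.
set L := ln q0^-1; have L0 : 0 < L by rewrite ln_gt0 // invf_gt1.
pose V (x : R) := x * expR (- 2 * ln x ^+ 2 / L).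
apply: (@even_weight_representation R T V _ _ symT _ _ (fun n => lognormal_moment n L0)).
- move=> x; rewrite in_itv /= andbT => x0; apply: cvgM; first exact: cvg_id.
  apply: continuous_comp; last exact: continuous_expR.
  apply: cvgM; last exact: cvg_cst; apply: cvgM; first exact: cvg_cst.
  apply: (@continuous_comp _ _ _ (@ln R) (fun y => y ^+ 2)); first exact: continuous_ln.
  exact: exprn_continuous.
- by move=> x; rewrite in_itv /= andbT => x0; rewrite mulr_ge0 ?expR_ge0 ?ltW.
move=> k; rewrite (symSW_real_moment q_gt0 hq hS sigmaT); congr (_%:C).
set h := Num.sqrt q0; have h0 : 0 < h by rewrite sqrtr_gt0.
have h2 : h ^+ 2 = q0 by rewrite sqr_sqrtr // ltW.
have eL : expR (L / 2) = h^-1.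
  have -> : L / 2 = - ln h.
    by rewrite /L lnV // -h2 lnXn // -mulr_natr; field.
  by rewrite expRN lnK.
have eJ : expR ((2 * k).+2%:R ^+ 2 * L / 8) = h ^- (k.+1 ^ 2).
  rewrite -exprVn -eL -expRM_natl; congr expR.
  have -> : (2 * k).+2 = (2 * k.+1)%N by lia.
  by rewrite natrX natrM; field.
have cK : Num.sqrt (q0 / (2 * pi * L)) * (2 * Num.sqrt (pi * L / 2)) = h.
  have -> : 2 * Num.sqrt (pi * L / 2) = Num.sqrt (2 * pi * L).
    rewrite -{1}[2](@ger0_norm R) // -sqrtr_sqr -sqrtrM ?sqr_ge0 //.
    by congr Num.sqrt; field.
  have pL : 0 < 2 * pi * L by rewrite !mulr_gt0 // pi_gt0.
  by rewrite -sqrtrM ?divr_ge0 ?(ltW pL) ?(ltW q_gt0) // divfK // gt_eqF.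
have mm (a b c d : R) : a * (b * (c * d)) = c * (a * (b * d)) by ring.
rewrite eJ mm cK.
elim: k {eJ} => [|k IHk]; first by rewrite /SW_moment big_ord0 expr1 mulVf // gt_eqF.
rewrite /SW_moment big_ord_recr -/(SW_moment q0 0 k) /= IHk -/h mul0r subr0 mulr1.
have -> : h ^+ (k.+2 ^ 2) = h ^+ (k.+1 ^ 2) * (h ^+ 3 * q0 ^+ k).
  by rewrite -h2 -!exprM -!exprD; congr (_ ^+ _); lia.
have : h ^+ (k.+1 ^ 2) != 0 by rewrite expf_neq0 // gt_eqF.
have : q0 ^+ k != 0 by rewrite expf_neq0 // gt_eqF.
have : h != 0 by rewrite gt_eqF.
move: (h ^+ (k.+1 ^ 2)) (q0 ^+ k) => A B h_0 B0 A0; field.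
by rewrite h_0 A0 B0.
Qed.

Lemma continuous_powR (R : realType) (a x : R) :
  x \in `]0, +oo[ -> {for x, continuous (fun y => y `^ a)}.
Proof.
by move=> xP; apply: differentiable_continuous; apply/derivable1_diffP/derivable_powR.
Qed.

Section MellinIntegral.
Variables (R : realType) (q c : R).
Hypotheses (q0 : 0 < q) (q1 : q < 1) (c0 : 0 < c).
Local Notation mu := (@lebesgue_measure R).

(** The integrand x^(a - 1) / (- c x; q)_oo dx of a Mellin transform, in the variable t = ln x. *)
Definition mellin_kernel (a t : R) : R :=
  expR (a * t) / qpoch_inf (- (c * expR t)) q.

Let ce_gt0 t : 0 < c * expR t.
Proof. by rewrite mulr_gt0 ?expR_gt0. Qed.

Lemma mellin_kernel_gt0 a t : 0 < mellin_kernel a t.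
Proof. by rewrite divr_gt0 ?expR_gt0 // qpoch_infN_gt0 // ltW. Qed.

Lemma continuous_mellin_kernel a : continuous (mellin_kernel a).
Proof.
move=> t; apply: cvgM.
  apply: (@continuous_comp _ _ _ (fun t => a * t) expR); last exact: continuous_expR.
  by apply: cvgM; [exact: cvg_cst|exact: cvg_id].
apply: (@continuous_comp _ _ _ (fun t => c * expR t) (fun z => (qpoch_inf (- z) q)^-1)).
  by apply: cvgM; [exact: cvg_cst|exact: continuous_expR].
exact: continuous_inv_qpoch_inf.
Qed.

Lemma integral_expR_abs (b : R) : 0 < b ->
  (\int[mu]_t (expR (- b * `|t|))%:E < +oo)%E.
Proof.
move=> b0; rewrite ge0_symfun_integralT.
- apply: lte_mul_pinfty => //.
  apply: (@le_lt_trans _ _ (\int[mu]_t ((b^-1)%:E * (exponential_pdf b t)%:E))%E); last first.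
    rewrite integralZl //; last exact: integrable_exponential_pdf.
    by rewrite integral_exponential_pdf // mule1 ltry.
  have -> : (\int[mu]_(t in [set x | (0 <= x)%R]) (expR (- b * `|t|))%:E =
      \int[mu]_(t in [set x | (0 <= x)%R]) ((b^-1)%:E * (exponential_pdf b t)%:E))%E.
    apply: eq_integral => t; rewrite inE /= => t0.
    by rewrite exponential_pdfE // -EFinM mulrA mulVf ?gt_eqF // mul1r ger0_norm.
  apply: ge0_subset_integral => //.
  - by rewrite -set_itvcy; exact: measurable_itv.
  - apply: emeasurable_funM => //; apply/measurable_EFinP.
    exact: measurable_exponential_pdf.
  - move=> t _; rewrite -EFinM lee_fin mulr_ge0 ?invr_ge0 ?(ltW b0) //.
    exact: exponential_pdf_ge0 (ltW b0) t.
- by move=> t; rewrite expR_ge0.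
- move=> t; apply: (@continuous_comp _ _ _ (fun t => - b * `|t|) expR); last exact: continuous_expR.
  by apply: cvgM; [exact: cvg_cst|exact: norm_continuous].
- by move=> t /=; rewrite normrN.
Qed.

(** The numerator gives the decay at -oo. At +oo the product beats every power, and a
power N >= a + 1 of e^t is enough. *)
Lemma mellin_kernel_dominated a : 0 < a ->
  exists M b, [/\ 0 <= M, 0 < b & forall t, mellin_kernel a t <= M * expR (- b * `|t|)].
Proof.
move=> a0; pose N := (Num.bound a).+1.
have aN : a + 1 <= N%:R by rewrite -natr1 lerD2r (ltW (archi_boundP (ltW a0))).
have [M M0 HM] := inv_qpoch_inf_decay q0 q1 N.
exists (1 + M * c ^- N), (Num.min a 1); split.
- by rewrite addr_ge0 // mulr_ge0 // invr_ge0 exprn_ge0 // ltW.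
- by rewrite lt_min a0 /=.
move=> t; have MN0 : 0 <= M * c ^- N by rewrite mulr_ge0 // invr_ge0 exprn_ge0 // ltW.
have [t0|/ltW t0] := leP t 0.
  apply: (@le_trans _ _ (expR (a * t))).
    rewrite /mellin_kernel ler_piMr ?expR_ge0 // invf_le1 ?qpoch_infN_gt0 ?(ltW (ce_gt0 t)) //.
    by rewrite qpoch_infN_ge1 // ltW.
  apply: (@le_trans _ _ (expR (- Num.min a 1 * `|t|))); last first.
    by rewrite ler_peMl ?expR_ge0 // lerDl.
  by rewrite ler_expR ler0_norm // mulrNN -subr_ge0 -mulrBl mulr_le0 // subr_le0 ge_min lexx.
apply: (@le_trans _ _ (M * c ^- N * expR (- t))).
  rewrite /mellin_kernel; apply: (@le_trans _ _ (expR (a * t) * (M * (c * expR t) ^- N))).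
    by rewrite ler_wpM2l ?expR_ge0 // HM.
  rewrite exprMn invfM -expRM_natl -expRN.
  have -> : expR (a * t) * (M * (c ^- N * expR (- (N%:R * t)))) =
      M * c ^- N * expR (a * t - N%:R * t) by rewrite expRD; ring.
  rewrite ler_wpM2l // ler_expR -mulrBl.
  by have : 0 <= (N%:R - (a + 1)) * t; [rewrite mulr_ge0 // subr_ge0|lra].
apply: ler_pM => //; rewrite ?expR_ge0 // ?lerDr //.
by rewrite ler_expR ger0_norm // mulNr lerN2 ler_piMl // ge_min lexx orbT.
Qed.

Lemma measurable_mellin_kernel a : measurable_fun setT (mellin_kernel a).
Proof. exact: continuous_measurable_fun (@continuous_mellin_kernel a). Qed.

Lemma integrable_mellin_kernel a : 0 < a ->
  mu.-integrable setT (EFin \o mellin_kernel a).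
Proof.
move=> a0; have [M [b [M0 b0 HM]]] := mellin_kernel_dominated a0.
have mE : measurable_fun [set: R] (fun t : R => (expR (- b * `|t|))%:E).
  apply/measurable_EFinP; apply: continuous_measurable_fun => t.
  apply: (@continuous_comp _ _ _ (fun t => - b * `|t|) expR); last exact: continuous_expR.
  by apply: cvgM; [exact: cvg_cst|exact: norm_continuous].
apply: (@le_integrable _ _ _ mu setT measurableT _ (fun t => M%:E * (expR (- b * `|t|))%:E)%E).
- by apply/measurable_EFinP; exact: measurable_mellin_kernel.
- move=> t _; rewrite -EFinM /= lee_fin ger0_norm ?(ltW (mellin_kernel_gt0 a t)) //.
  by rewrite ger0_norm ?HM // mulr_ge0 ?expR_ge0.
apply: integrableZl => //; apply/integrableP; split=> //.
under eq_integral do rewrite gee0_abs ?lee_fin ?expR_ge0 //.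
exact: integral_expR_abs.
Qed.

Definition mellin (a : R) : R := \int[mu]_t mellin_kernel a t.

Lemma integral_mellin_kernel a : 0 < a ->
  (\int[mu]_t (mellin_kernel a t)%:E = (mellin a)%:E)%E.
Proof.
move=> a0; rewrite /mellin /Rintegral fineK //.
exact: integrable_fin_num (integrable_mellin_kernel a0).
Qed.

(** The substitution t -> k t + d: scaling (k = 2) is y = x^2 and translation (d = ln q) is
y -> q y in the original variable. *)
Lemma mellin_kernel_affine a (k d : R) : 0 < k ->
  (\int[mu]_t (mellin_kernel a t)%:E =
   \int[mu]_t (k * mellin_kernel a (k * t + d))%:E)%E.
Proof.
move=> k0; pose F t := k * t + d.
have dF : derive1 F = cst k.
  apply/funext => t; rewrite derive1E /F derive_val.
  by rewrite /GRing.scale /=; ring.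
rewrite (@increasing_ge0_integration_by_substitutionT _ F) ?dF.
- by apply: eq_integral => t _; rewrite /= mulrC.
- by move=> x y xy; rewrite /F ltrD2r ltr_pM2l.
- by move=> t; exact: cvg_cst.
- exact: is_cvg_cst.
- exact: is_cvg_cst.
- by move=> t.
- apply/cvgrNyPle => A; near=> t.
  have : t <= (A - d) / k by near: t; apply: nbhs_ninfty_le; exact: num_real.
  by rewrite ler_pdivlMr // /F mulrC lerBrDr.
- apply/cvgryPge => A; near=> t.
  have : (A - d) / k <= t by near: t; apply: nbhs_pinfty_ge; exact: num_real.
  by rewrite ler_pdivrMr // /F mulrC lerBlDr.
- exact: continuous_mellin_kernel.
- by move=> t; exact: ltW (mellin_kernel_gt0 _ _).
Unshelve. all: by end_near. Qed.

(** Translation by ln q replaces the product at y = c e^t by the product at q y, and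
(- y; q)_oo = (1 + y) (- q y; q)_oo splits the translated kernel into two. At a = p + n
with q^p = w this is the moment recurrence of T. *)
Lemma mellin_shift a : 0 < a -> expR (a * ln q) * (mellin a + c * mellin (a + 1)) = mellin a.
Proof.
move=> a0; have a1 : 0 < a + 1 by rewrite addr_gt0.
apply/esym; rewrite /mellin {1}/Rintegral (mellin_kernel_affine a (ln q) ltr01).
rewrite -/(Rintegral mu setT (fun t => 1 * mellin_kernel a (1 * t + ln q))).
rewrite -RintegralZl //; last exact: integrable_mellin_kernel.
have ic : mu.-integrable setT (EFin \o (fun t => c * mellin_kernel (a + 1) t)).
  have -> : EFin \o (fun t => c * mellin_kernel (a + 1) t) =
      (fun t => c%:E * (EFin \o mellin_kernel (a + 1)) t)%E.
    by apply/funext => t /=; rewrite EFinM.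
  by apply: integrableZl => //; exact: integrable_mellin_kernel.
rewrite -RintegralD //; last exact: integrable_mellin_kernel.
rewrite -RintegralZl //; last first.
  have -> : EFin \o (fun t => mellin_kernel a t + c * mellin_kernel (a + 1) t) =
     ((EFin \o mellin_kernel a) \+ (EFin \o (fun t => (c * mellin_kernel (a + 1) t)%R)))%E.
    by apply/funext => t /=; rewrite EFinD.
  by apply: integrableD => //; exact: integrable_mellin_kernel.
apply: eq_Rintegral => t _; rewrite !mul1r /mellin_kernel.
have -> : expR (t + ln q) = q * expR t by rewrite expRD lnK // mulrC.
rewrite (qpoch_infN_shift q0 q1 (ltW (ce_gt0 t))) [c * (q * _)]mulrCA.
have E0 : qpoch_inf (- (q * (c * expR t))) q != 0.
  by rewrite gt_eqF // qpoch_infN_gt0 // mulr_ge0 ?ltW.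
have C0 : 1 + c * expR t != 0 by rewrite gt_eqF // addr_gt0.
have -> : expR (a * (t + ln q)) = expR (a * ln q) * expR (a * t).
  by rewrite -expRD; congr expR; ring.
have -> : expR ((a + 1) * t) = expR (a * t) * expR t.
  by rewrite -expRD; congr expR; ring.
by field; rewrite E0 C0.
Qed.

(** Positivity makes the normalizing constant K, the inverse of this integral, meaningful.
The kernel is bounded below on [0, 1], where e^(a t) >= 1 and the product is largest at t = 1. *)
Lemma mellin_gt0 a : 0 < a -> 0 < mellin a.
Proof.
move=> a0; set m := (qpoch_inf (- (c * expR 1)) q)^-1.
have m0 : 0 < m by rewrite invr_gt0 qpoch_infN_gt0 // ltW.
apply: (@lt_le_trans _ _ m) => //; rewrite -lee_fin -integral_mellin_kernel //.
apply: (@le_trans _ _ (\int[mu]_(t in `[0%R, 1%R]) m%:E)%E).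
  by rewrite integral_cst //= lebesgue_measure_itv /= lte_fin ltr01 oppr0 adde0 mule1.
apply: (@le_trans _ _ (\int[mu]_(t in `[0%R, 1%R]) (mellin_kernel a t)%:E)%E).
  apply: ge0_le_integral => //.
  - by move=> t _; rewrite lee_fin ltW.
  - by apply/measurable_EFinP/measurable_funTS; exact: measurable_mellin_kernel.
  - move=> t; rewrite /= in_itv /= => /andP[t0 t1]; rewrite lee_fin.
    rewrite /mellin_kernel -[m]mul1r ler_pM ?(ltW m0) //.
      by rewrite -expR0 ler_expR mulr_ge0 // ltW.
    rewrite lef_pV2 ?posrE ?qpoch_infN_gt0 ?(ltW (ce_gt0 _)) //.
    by rewrite qpoch_infN_homo ?(ltW (ce_gt0 _)) // ler_pM2l // ler_expR.
apply: ge0_subset_integral => //.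
- by apply/measurable_EFinP; exact: measurable_mellin_kernel.
- by move=> t _; rewrite lee_fin ltW // mellin_kernel_gt0.
Qed.

Let halfline_density (a x : R) : R := x `^ (a - 1) / qpoch_inf (- (c * x)) q.

Let halfline_density_expR a t :
  halfline_density a (expR t) * expR t = mellin_kernel a t.
Proof.
rewrite /halfline_density /powR gt_eqF ?expR_gt0 // expRK mulrAC -expRD.
by congr (expR _ / _); ring.
Qed.

Lemma halfline_mellin a : 0 < a ->
  mu.-integrable `[0, +oo[ (EFin \o (fun x => x `^ (a - 1) / qpoch_inf (- (c * x)) q)) /\
  \int[mu]_(x in `[0, +oo[) (x `^ (a - 1) / qpoch_inf (- (c * x)) q) = mellin a.
Proof.
move=> a0; rewrite -/(halfline_density a).
have cD : {in `]0, +oo[, continuous (halfline_density a)}.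
  move=> x xP; have x0 : 0 < x by move: xP; rewrite in_itv /= andbT.
  apply: cvgM; first exact: continuous_powR.
  apply: (@continuous_comp _ _ _ (fun t => c * t) (fun z => (qpoch_inf (- z) q)^-1)).
    by apply: cvgM; [exact: cvg_cst|exact: cvg_id].
  by apply: continuous_inv_qpoch_inf => //; rewrite mulr_gt0.
have D0 x : 0 <= x -> 0 <= halfline_density a x.
  by move=> x0; rewrite divr_ge0 ?powR_ge0 // ltW // qpoch_infN_gt0 // mulr_ge0 // ltW.
have mD : measurable_fun (`]0, +oo[ : set R) (halfline_density a).
  apply: open_continuous_measurable_fun; first exact: interval_open.
  by move=> x; rewrite inE /= => x0; exact: cD.
have mDc : measurable_fun (`[0, +oo[ : set R) (halfline_density a).
  by apply/measurable_fun_itv_obnd_cbndP.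
have I : (\int[mu]_(x in `[0%R, +oo[) (halfline_density a x)%:E = (mellin a)%:E)%E.
  rewrite -integral_itv_obnd_cbnd; last exact/measurable_EFinP.
  rewrite (ge0_integral_expR_subst cD); last first.
    by move=> x; rewrite in_itv /= andbT => /ltW; exact: D0.
  rewrite -integral_mellin_kernel //; apply: eq_integral => t _.
  by rewrite halfline_density_expR.
split; last by rewrite /Rintegral I.
apply/integrableP; split; first exact/measurable_EFinP.
rewrite [ltLHS](_ : _ = (mellin a)%:E) ?ltry // -I.
apply: eq_integral => x; rewrite inE /= in_itv /= andbT => x0.
by rewrite ger0_norm // D0.
Qed.

(** The factor 1/2 and the parameter p + n / 2 come from y = x^2. *)
Lemma symmetric_mellin (p : R) n : 0 < p ->
  (\int[mu]_t ((expR t `^ (2 * p - 1) / qpoch_inf (- (c * expR t ^+ 2)) q)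
     * expR t ^+ n.+1)%:E = (mellin (p + n%:R / 2) / 2)%:E)%E.
Proof.
move=> p0; have a0 : 0 < p + n%:R / 2 by rewrite ltr_wpDr // divr_ge0.
rewrite [mellin _ / 2]mulrC EFinM -integral_mellin_kernel // (mellin_kernel_affine _ 0 (ltr0n R 2)).
rewrite -ge0_integralZl_EFin ?invr_ge0 //.
- apply: eq_integral => t _; rewrite -EFinM; congr (_%:E).
  rewrite [RHS]mulrA mulVf // mul1r addr0.
  rewrite /powR gt_eqF ?expR_gt0 // expRK /mellin_kernel -!expRM_natl mulrAC -expRD.
  by congr (expR _ / _); rewrite -natr1; field.
- by move=> t _; rewrite lee_fin mulr_ge0 // ltW // mellin_kernel_gt0.
- apply/measurable_EFinP; apply: measurable_funM => //.
  apply: measurableT_comp; first exact: measurable_mellin_kernel.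
  by apply: measurable_funD => //; apply: measurable_funM.
Qed.

End MellinIntegral.

Section MellinRepresentation.
Variables (R : realType) (q0 w0 c p : R).
Hypotheses (q_gt0 : 0 < q0) (q_lt1 : q0 < 1) (w_gt0 : 0 < w0) (p_gt0 : 0 < p).
Hypotheses (cE : c = Num.sqrt q0 ^+ 3 * w0^-1) (pE : expR (p * ln q0) = w0).

Let h_gt0 : 0 < Num.sqrt q0. Proof. by rewrite sqrtr_gt0. Qed.

Let c_gt0 : 0 < c.
Proof. by rewrite cE mulr_gt0 ?exprn_gt0 ?invr_gt0. Qed.

Lemma mellinS n : mellin q0 c (p + n.+1%:R) =
  Num.sqrt q0 ^- 3 * q0 ^- n * (1 - w0 * q0 ^+ n) * mellin q0 c (p + n%:R).
Proof.
have pn : 0 < p + n%:R by rewrite ltr_wpDr.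
have := mellin_shift q_gt0 q_lt1 c_gt0 pn.
have -> : expR ((p + n%:R) * ln q0) = w0 * q0 ^+ n.
  by rewrite mulrDl expRD pE expRM_natl (lnK q_gt0).
rewrite -addrA natr1 cE.
have : q0 ^+ n != 0 by rewrite expf_neq0 // gt_eqF.
have : Num.sqrt q0 != 0 by rewrite gt_eqF.
have : w0 != 0 by rewrite gt_eqF.
move: (mellin q0 _ (p + n%:R)) (mellin q0 _ (p + n.+1%:R)) => A B.
move: (Num.sqrt q0) (q0 ^+ n) => h Q w1 h0 Q0 E.
apply: (@mulfI _ (h ^+ 3 * Q)); first by rewrite mulf_neq0 // expf_neq0.
have -> : h ^+ 3 * Q * B = w0 * Q * (A + h ^+ 3 * w0^-1 * B) - w0 * Q * A.
  by field.
by rewrite E; field; rewrite Q0 h0.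
Qed.

Lemma mellin_SW_moment n : mellin q0 c (p + n%:R) = SW_moment q0 w0 n * mellin q0 c p.
Proof.
elim: n => [|n IHn]; first by rewrite /SW_moment big_ord0 addr0 mul1r.
by rewrite mellinS IHn {2}/SW_moment big_ord_recr -/(SW_moment q0 w0 n) /=; ring.
Qed.

Let V (x : R) := x `^ (2 * p - 1) / qpoch_inf (- (c * x ^+ 2)) q0.

Let cV : {in `]0, +oo[, continuous V}.
Proof.
move=> x xP; have x0 : 0 < x by move: xP; rewrite in_itv /= andbT.
apply: cvgM; first exact: continuous_powR.
apply: (@continuous_comp _ _ _ (fun y : R => c * y ^+ 2) (fun z : R => (qpoch_inf (- z) q0)^-1)).
  by apply: cvgM; [exact: cvg_cst|exact: exprn_continuous].
by apply: continuous_inv_qpoch_inf; rewrite ?mulr_gt0 ?exprn_gt0.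
Qed.

Let V0 : {in `]0, +oo[, forall x, 0 <= V x}.
Proof.
move=> x; rewrite in_itv andbT => x0; apply: divr_ge0; first exact: powR_ge0.
by rewrite ltW // qpoch_infN_gt0 // mulr_ge0 ?sqr_ge0 // ltW.
Qed.

Lemma mellin_representation (S T : polyform R[i]) :
  Ctilde q0%:C -> is_SW q0%:C w0%:C S -> symmetrical T -> form_sigma T =1 S ->
  let W (x : R) := `|x| `^ (2 * p - 1) / qpoch_inf (- (c * x ^+ 2)) q0 in
  forall f : {poly R[i]},
    Cintegrable (fun x : R => (W x)%:C * f.[x%:C]) /\
    T f = (mellin q0 c p)^-1%:C * Cintegral (fun x : R => (W x)%:C * f.[x%:C]).
Proof.
move=> hq hS symT sigmaT W.
have -> : W = (fun x => V `|x|) by apply/funext => x; rewrite /W /V real_normK ?num_real.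
apply: (even_weight_representation symT cV V0
  (fun n => symmetric_mellin q_gt0 q_lt1 c_gt0 n p_gt0)) => n.
rewrite (symSW_real_moment q_gt0 hq hS sigmaT); congr (_%:C).
have -> : (2 * n)%N%:R / 2 = n%:R :> R by rewrite natrM; field.
have := mellin_gt0 q_gt0 q_lt1 c_gt0 p_gt0.
by rewrite mellin_SW_moment; move: (mellin q0 c p) => M M0; field; rewrite gt_eqF.
Qed.

End MellinRepresentation.

Lemma powR_representation (R : realType) (q0 w0 : R) (S T : polyform R[i]) :
  Ctilde q0%:C -> is_SW q0%:C w0%:C S -> symmetrical T -> form_sigma T =1 S ->
  0 < q0 -> q0 < 1 -> 0 < w0 -> w0 < 1 ->
  let k (x : R) :=
    x `^ (ln w0 / ln q0 - 1) /
      qpoch_inf (- (q0 `^ (3 / 2) * w0^-1 * x)) q0 in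
  let K := (\int[lebesgue_measure]_(x in `[0, +oo[) k x)^-1 in
  let W (x : R) :=
    `|x| `^ (2 * (ln w0 / ln q0) - 1) /
      qpoch_inf (- (q0 `^ (3 / 2) * w0^-1 * x ^+ 2)) q0 in
  lebesgue_measure.-integrable `[0, +oo[ (EFin \o k) /\
  forall f : {poly R[i]},
    Cintegrable (fun x : R => (W x)%:C * f.[x%:C]) /\
    T f = K%:C * Cintegral (fun x : R => (W x)%:C * f.[x%:C]).
Proof.
move=> hq hS symT sigmaT q_gt0 q_lt1 w_gt0 w_lt1.
have lnq : ln q0 < 0 by rewrite ln_lt0 // q_gt0.
have pE : expR (ln w0 / ln q0 * ln q0) = w0 by rewrite divfK ?lt_eqF // lnK.
have p0 : 0 < ln w0 / ln q0 by rewrite ltr_ndivlMr // mul0r ln_lt0 // w_gt0.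
have cE : q0 `^ (3 / 2) * w0^-1 = Num.sqrt q0 ^+ 3 * w0^-1.
  congr (_ * _); rewrite [3 / 2]mulrC powRrM (powR12_sqrt (ltW q_gt0)).
  exact: (powR_mulrn 3 (sqrtr_ge0 q0)).
have c0 : 0 < q0 `^ (3 / 2) * w0^-1 by rewrite mulr_gt0 ?powR_gt0 ?invr_gt0.
move: (ln w0 / ln q0) (q0 `^ (3 / 2) * w0^-1) p0 pE cE c0 => p c p0 pE cE c0 k K W.
have [ik Ik] := halfline_mellin q_gt0 q_lt1 c0 p0.
have -> : K = (mellin q0 c p)^-1 by rewrite /K /k Ik.
by split; [exact: ik|exact: (mellin_representation q_gt0 q_lt1 w_gt0 p0 cE pE hq hS symT sigmaT)].
Qed.

(** * The symmetrical form T *)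

Theorem mainTheorem9 (R : realType) (q w : R[i]) (S T : polyform R[i])
    (hq : Ctilde q) (hS : is_SW q w S)
    (symT : symmetrical T) (sigmaT : form_sigma T =1 S) :
  (* 1 *)
  ((regular_form T <-> forall n : nat, w != q ^- n) /\
   (regular_form T ->
     exists gamma : nat -> R[i],
       recurrence_coefficients T (fun=> 0) gamma /\
       forall n : nat,
         gamma (2 * n + 1)%N = sqrtc q ^- (4 * n + 3) * (1 - w * q ^+ n) /\
         gamma (2 * n + 2)%N = sqrtc q ^- (4 * n + 5) * (1 - q ^+ n.+1)) /\
   (0 < q -> q < 1 -> w < 1 -> positive_definite T)) /\
  (* 2 *)
  (w != sqrtc q -> (forall n : nat, w != q ^- n) ->
    H_semiclassical_of_class (sqrtc q) T 1 /\
    H_equation (sqrtc q)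
      ('X * ('X^2 + (w * sqrtc q ^- 3)%:P))
      (- ((sqrtc q - 1)^-1 *: ('X^2 + ((w - 1) * sqrtc q ^- 3)%:P))) T) /\
  (* 3 *)
  (forall n : nat,
    moment T (2 * n) = sqrtc q ^- (n * (n + 2)) * qpoch w q n /\
    moment T (2 * n + 1) = 0) /\
  (* 4 *)
  (forall q0 w0 : R, q = q0%:C -> w = w0%:C -> 1 < q0 -> 1 < w0 ->
    let z (k : nat) : R[i] :=
      'i%C * (Num.sqrt w0 * q0 `^ (- (k%:R / 2) - 3 / 4))%:C in
    is_form_series T (qpoch_inf w0^-1 q0^-1)%:C
      (fun (k : nat) (f : {poly R[i]}) =>
        (w0 ^- k / qpoch q0^-1 q0^-1 k)%:C *
        ((horner_eval (- z k) f + horner_eval (z k) f) / 2))) /\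
  (* 5 *)
  (forall q0 w0 : R, q = q0%:C -> w = w0%:C ->
    0 < q0 -> q0 < 1 -> 0 < w0 -> w0 < 1 ->
    let k (x : R) :=
      x `^ (ln w0 / ln q0 - 1) /
        qpoch_inf (- (q0 `^ (3 / 2) * w0^-1 * x)) q0 in
    let K := (\int[lebesgue_measure]_(x in `[0, +oo[) k x)^-1 in
    let W (x : R) :=
      `|x| `^ (2 * (ln w0 / ln q0) - 1) /
        qpoch_inf (- (q0 `^ (3 / 2) * w0^-1 * x ^+ 2)) q0 in
    lebesgue_measure.-integrable `[0, +oo[ (EFin \o k) /\
    forall f : {poly R[i]},
      Cintegrable (fun x : R => (W x)%:C * f.[x%:C]) /\
      T f = K%:C * Cintegral (fun x : R => (W x)%:C * f.[x%:C])) /\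
  (* 6 *)
  (forall q0 : R, q = q0%:C -> w = 0 -> 0 < q0 -> q0 < 1 ->
    let W (x : R) := `|x| * expR (- 2 * ln `|x| ^+ 2 / ln q0^-1) in
    forall f : {poly R[i]},
      Cintegrable (fun x : R => (W x)%:C * f.[x%:C]) /\
      T f = (Num.sqrt (q0 / (2 * pi * ln q0^-1)))%:C *
            Cintegral (fun x : R => (W x)%:C * f.[x%:C])).
Proof.
split; first split; first exact: (symSW_regularP hq hS symT sigmaT).
  split=> [rT|]; last exact: symSW_positive_definite hq hS symT sigmaT.
  exists (sw_gamma (sqrtc q) w); split; last exact: symSW_gamma.
  exact: (symSW_recurrence hq hS symT sigmaT ((symSW_regularP hq hS symT sigmaT).1 rT)).
split; first exact: (symSW_semiclassical hq hS symT sigmaT).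
split; first exact: (symSW_moment hq hS symT sigmaT).
split.
  move=> q0 w0 qE wE; move: hq hS; rewrite qE wE => hq0 hS0.
  exact: discrete_representation symT sigmaT.
split.
  move=> q0 w0 qE wE; move: hq hS; rewrite qE wE => hq0 hS0.
  exact: powR_representation symT sigmaT.
move=> q0 qE wE; move: hq hS; rewrite qE wE => hq0 hS0.
exact: lognormal_representation symT sigmaT.
Qed.
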